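(* Let $\delta\in(0,n]$, $p\in(1,\infty)$, and let $w$ be a ($\mathcal H^\delta_\infty$-)capacitary weight on $\mathbb R^n$. Then the maximal operator $\mathcal M_{\mathcal H^\delta_\infty}: L^{p,\infty}_w(\mathbb R^n,\mathcal H^\delta_\infty)\to L^{p,\infty}_w(\mathbb R^n,\mathcal H^\delta_\infty)$ is bounded, i.e. there exists a constant $K>0$ such that for every $f\in L^{p,\infty}_w(\mathbb R^n,\mathcal H^\delta_\infty)$, $$\left\|\mathcal M_{\mathcal H^\delta_\infty}f\right\|_{L^{p,\infty}_w(\mathbb R^n,\mathcal H^\delta_\infty)}\le K\|f\|_{L^{p,\infty}_w(\mathbb R^n,\mathcal H^\delta_\infty)},$$ if and only if $w\in\mathcal A_{p,\delta}$.
   Context: A cube $Q\subset\mathbb R^n$ is a left-open right-closed cube with sides parallel to the axes; $l(Q)$ is its edge length. For $\delta\in(0,n]$ and $E\subset\mathbb R^n$, the Hausdorff content is $\mathcal H^\delta_\infty(E):=\inf\{\sum_i l(Q_i)^\delta:\ E\subset\bigcup_i Q_i\}$, the infimum over all finite or countable coverings of $E$ by cubes. For $E\subset\mathbb R^n$ and a non-negative function $g$ (no measurability required) the Choquet integral is $\int_E g\,d\mathcal H^\delta_\infty:=\int_0^\infty \mathcal H^\delta_\infty(\{x\in E: g(x)>t\})\,dt$. ''Almost everywhere'' with respect to $\mathcal H^\delta_\infty$ means outside a set of zero $\mathcal H^\delta_\infty$-content. A capacitary weight is a non-negative function $w$ with $\int_E w\,d\mathcal H^\delta_\infty<\infty$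 for all compact $E$ and $w\in(0,\infty)$ $\mathcal H^\delta_\infty$-almost everywhere; $w_{\mathcal H^\delta_\infty}(F):=\int_F w\,d\mathcal H^\delta_\infty$. $L^{p,\infty}_w(\mathbb R^n,\mathcal H^\delta_\infty)$ is the set of functions $f$ with $\|f\|_{L^{p,\infty}_w(\mathbb R^n,\mathcal H^\delta_\infty)}:=\sup_{t>0}t\,\bigl(w_{\mathcal H^\delta_\infty}(\{x\in\mathbb R^n:|f(x)|>t\})\bigr)^{1/p}<\infty$. $\mathcal M_{\mathcal H^\delta_\infty}f(x):=\sup_{Q\ni x}\frac1{\mathcal H^\delta_\infty(Q)}\int_Q|f(y)|\,d\mathcal H^\delta_\infty\in[0,\infty]$, the supremum over all cubes containing $x$. For $p\in(1,\infty)$, $w\in\mathcal A_{p,\delta}$ means $w$ is a capacitary weight with $[w]_{\mathcal A_{p,\delta}}:=\sup_Q\{\frac1{\mathcal H^\delta_\infty(Q)}\int_Qw\,d\mathcal H^\delta_\infty\}\{\frac1{\mathcal H^\delta_\infty(Q)}\int_Qw^{-\frac1{p-1}}d\mathcal H^\delta_\infty\}^{p-1}<\infty$ (supremum over all cubes). *)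

(* Defs.v *)
From HB Require Import structures.
From mathcomp Require Import all_boot all_order all_algebra.
From mathcomp Require Import all_classical all_reals all_analysis.

Set Implicit Arguments.
Unset Strict Implicit.
Unset Printing Implicit Defensive.

Import Order.TTheory GRing.Theory Num.Theory.
Import numFieldNormedType.Exports.

Local Open Scope classical_set_scope.
Local Open Scope ring_scope.
Local Open Scope ereal_scope.

Section HausdorffContent.
Variables (R : realType) (n : nat).
Implicit Types (a x : 'rV[R]_n) (E F Q : set 'rV[R]_n).

Definition cube a (l : R) : set 'rV[R]_n :=
  [set x | forall i, (a ord0 i < x ord0 i <= a ord0 i + l)%R].

Definition cubes : set (set 'rV[R]_n) :=
  [set Q | exists a, exists2 l : R, (0 < l)%R & Q = cube a l].

Variable delta : R.

(* The index set [D] is an arbitrary set of naturals, so that both finite and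
   countably infinite coverings are allowed. *)
Definition hausdorff_content E : \bar R :=
  ereal_inf [set s | exists (D : set nat) (a : nat -> 'rV[R]_n) (l : nat -> R),
    [/\ (forall i, D i -> (0 < l i)%R),
        E `<=` \bigcup_(i in D) cube (a i) (l i) &
        s = \esum_(i in D) (l i `^ delta)%:E]].

(* The integrand is nonincreasing in [t], hence Lebesgue measurable, whatever
   the function [g] is. *)
Definition choquet E (g : 'rV[R]_n -> \bar R) : \bar R :=
  \int[@lebesgue_measure R]_(t in `[0%R, +oo[)
    hausdorff_content [set x | E x /\ t%:E < g x].

Definition content_ae (P : 'rV[R]_n -> Prop) : Prop :=
  exists2 N, hausdorff_content N = 0 & forall x, ~ N x -> P x.

Definition choquet_avg Q (g : 'rV[R]_n -> \bar R) : \bar R :=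
  (hausdorff_content Q)^-1 * choquet Q g.

Definition capacitary_weight (w : 'rV[R]_n -> \bar R) : Prop :=
  [/\ (forall x, 0 <= w x),
      (forall E, compact E -> choquet E w < +oo) &
      content_ae (fun x => 0 < w x < +oo)].

Definition weak_norm (p : R) (w f : 'rV[R]_n -> \bar R) : \bar R :=
  ereal_sup [set t%:E * (choquet [set x | t%:E < `|f x|] w) `^ p^-1
            | t in [set t : R | (0 < t)%R]].

Definition weak_Lp (p : R) (w : 'rV[R]_n -> \bar R) :
    set ('rV[R]_n -> \bar R) :=
  [set f | weak_norm p w f < +oo].

Definition maximal (f : 'rV[R]_n -> \bar R) (x : 'rV[R]_n) : \bar R :=
  ereal_sup [set choquet_avg Q (fun y => `|f y|)
            | Q in [set Q | cubes Q /\ Q x]].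

(* [w^(-1/(p-1))] is written [(w^-1)^(1/(p-1))]: the inverse on [\bar R] maps 0
   to +oo and +oo to 0, whereas [poweR] with a negative exponent maps 0 to 0
   and +oo to +oo. *)
Definition Ap_const (p : R) (w : 'rV[R]_n -> \bar R) : \bar R :=
  ereal_sup [set choquet_avg Q w *
      (choquet_avg Q (fun x => (w x)^-1 `^ (p - 1)^-1)) `^ (p - 1)
    | Q in cubes].

Definition Ap (p : R) (w : 'rV[R]_n -> \bar R) : Prop :=
  capacitary_weight w /\ Ap_const p w < +oo.

End HausdorffContent.

(* Main.v *)
(* The necessity is the classical testing argument: on a cube [Q], apply the
   bound to the truncations of [w ^ (- 1 / (p - 1))] restricted to [Q].

   For the sufficiency, the Hausdorff content is replaced by the comparable
   content defined by dyadic coverings, and Choquet integrals by sums over the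
   levels [2 ^ k].  The [A_p] condition forces the median of
   [sigma = w ^ (- 1 / (p - 1))] on a dyadic cube to be comparable to its
   average.  Modifying an optimal covering of a superlevel set, this gives
   [int_{sigma > s} sigma <= C s H(sigma > s)] on each cube above its average,
   hence a geometric gain in the decay of [H(sigma > s)]: this is the
   self-improvement of [A_p].  It bounds the weight of a dyadic cube on which
   the average of [f] exceeds [2 ^ k] by a sum, linear in the weight, of the
   weights of the superlevel sets of [f] in that cube, with coefficients that
   are summable against the weak-type decay [2 ^ (- d p)].  These local
   estimates are added over a subfamily of the maximal cubes that satisfies a
   packing condition, chosen by Zorn's lemma; the cubes that were not chosen
   lie in cubes saturated by the chosen ones, whose weight is controlled by
   the [A_infty] property. *)
Require Import Defs.
From mathcomp Require Import all_boot all_order all_algebra.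
From mathcomp Require Import all_classical all_reals all_analysis.
From mathcomp Require Import measurable_realfun ring lra zify.

Set Implicit Arguments.
Unset Strict Implicit.
Unset Printing Implicit Defensive.

Import Order.TTheory GRing.Theory Num.Theory.
Import numFieldNormedType.Exports.

(** The content is not additive and the weight of a set is itself a Choquet integral, so neither
    linearisation nor duality is at hand and [f] is handled only through its superlevel sets. On one
    cube, splitting at [2 ^ r] times the average of [sigma] bounds the weight by two sums over the
    levels [2 ^ d] of [f]. Without self-improvement the choice [r = d] makes both borderline: their
    general terms are of order [2 ^ d * 2 ^ (- d)] and [2 ^ d * 2 ^ ((p - 1) d) * 2 ^ (- p d)]. The
    geometric gain in the decay of [sigma] leaves room to take [r] slightly smaller than [d], and
    then both converge. The same decay for [w] itself serves another purpose: along a growing chain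
    of cubes the weight tends to infinity, and this is what provides maximal cubes. Triples appear
    because a general cube may lie in no dyadic cube of comparable size. The necessity rests on the
    identity [sigma ^ p * w = sigma], which controls the weak norm of the truncations by their
    integral. *)

(** * Sums of non-negative terms over arbitrary index sets *)

Section Esum.
Local Open Scope classical_set_scope.
Local Open Scope ring_scope.
Local Open Scope ereal_scope.
Context {R : realType}.

Lemma esum_subset (T : choiceType) (A B : set T) (a : T -> \bar R) :
  A `<=` B -> \esum_(i in A) a i <= \esum_(i in B) a i.
Proof.
move=> AB; apply: ereal_sup_le => x /= [X [finX XA] <-].
by exists X => //; split => //; apply: subset_trans AB.
Qed.

Lemma esum_leP (T : choiceType) (A : set T) (a : T -> \bar R) (M : \bar R) :
  (forall X : seq T, uniq X -> (forall x, x \in X -> A x) ->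
    \sum_(i <- X) a i <= M) ->
  \esum_(i in A) a i <= M.
Proof.
move=> H; apply: ge_ereal_sup => _ [X [finX XA] <-].
rewrite fsbig_finite//=; apply: H; first exact: finmap.fset_uniq.
by move=> x; rewrite in_fset_set// => /set_mem /XA.
Qed.

Lemma sum_le_esum (T : choiceType) (A : set T) (a : T -> \bar R) (X : seq T) :
  uniq X -> (forall x, x \in X -> A x) ->
  \sum_(i <- X) a i <= \esum_(i in A) a i.
Proof.
move=> uX XA; rewrite (fsbig_seq _ _ uX); apply: ereal_sup_ubound.
by exists [set` X] => //; split=> // x /XA.
Qed.

Lemma esum_ge1 (T : choiceType) (A : set T) (a : T -> \bar R) (j : T) :
  (forall i, 0 <= a i) -> A j -> a j <= \esum_(i in A) a i.
Proof.
move=> a0 Aj; rewrite -[leLHS](@esum_set1 R T j a)//.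
by apply: esum_subset => _ ->.
Qed.

Lemma esumZ (T : choiceType) (A : set T) (a : T -> \bar R) (c : R) :
  (0 <= c)%R -> (forall i, 0 <= a i) ->
  \esum_(i in A) (c%:E * a i) = c%:E * \esum_(i in A) a i.
Proof.
rewrite le_eqVlt => /predU1P[<- _|c0 a0].
  by rewrite mul0e esum1// => i _; rewrite mul0e.
have H (b : R) (u : T -> \bar R) : (0 < b)%R -> (forall i, 0 <= u i) ->
    \esum_(i in A) (b%:E * u i) <= b%:E * \esum_(i in A) u i.
  move=> b0 u0; apply: esum_leP => X uX XA.
  rewrite -ge0_sume_distrr//.
  apply: lee_wpmul2l; first by rewrite lee_fin ltW.
  exact: sum_le_esum.
apply/eqP; rewrite eq_le H//=.
rewrite -lee_pdivlMl//.
have ->: \esum_(i in A) a i = \esum_(i in A) ((c^-1)%:E * (c%:E * a i)).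
  by apply: eq_esum => i _; rewrite muleA -EFinM mulVf ?mul1e// gt_eqF.
apply: H; first by rewrite invr_gt0.
by move=> i; rewrite mule_ge0// lee_fin ltW.
Qed.

Lemma esum_exchange (T1 T2 : choiceType) (A : set T1) (B : set T2)
    (a : T1 -> T2 -> \bar R) : (forall i j, 0 <= a i j) ->
  \esum_(i in A) \esum_(j in B) a i j = \esum_(j in B) \esum_(i in A) a i j.
Proof.
move=> a0; rewrite esum_esum// esum_esum//.
rewrite (@reindex_esum _ _ _ (A `*`` (fun=> B)) (B `*`` (fun=> A))
   (fun x => (x.2, x.1)))//.
split.
- by move=> [x y] /= [].
- by move=> [x y] [x' y'] _ _ /= [-> ->].
- by move=> [x y] /= [? ?]; exists (y, x).
Qed.

Lemma esum_if (T : choiceType) (A : set T) (P : T -> Prop) (a : T -> \bar R) :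
  \esum_(i in [set i | A i /\ P i]) a i =
  \esum_(i in A) if `[< P i >] then a i else 0.
Proof.
rewrite (_ : [set i | _ /\ _] = A `&` [set i | P i])//.
by rewrite esum_mkcondr.
Qed.

Lemma esum_bigcup_le (I T : choiceType) (J : set I) (A : I -> set T)
    (a : T -> \bar R) : (forall i, 0 <= a i) ->
  \esum_(i in \bigcup_(j in J) A j) a i <= \esum_(j in J) \esum_(i in A j) a i.
Proof.
move=> a0; set U := \bigcup_(j in J) A j.
have ->: \esum_(j in J) \esum_(i in A j) a i =
   \esum_(j in J) \esum_(i in U) (if `[< A j i >] then a i else 0).
  apply: eq_esum => j Jj; rewrite -esum_if; congr esum.
  apply/seteqP; split => x /=; last by case.
  by move=> Ax; split => //; exists j.
rewrite esum_exchange; last by move=> i j; case: ifP.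
apply: le_esum => i [j Jj Aji].
apply: le_trans (esum_ge1 (j := j) _ _) => //; last by move=> k; case: ifP.
by case: asboolP.
Qed.

Lemma esum_disjoint_le (I T : choiceType) (J : set I) (B : set T)
    (A : I -> set T) (a : T -> \bar R) : (forall i, 0 <= a i) ->
  (forall j j' i, J j -> J j' -> A j i -> A j' i -> j = j') ->
  \esum_(j in J) \esum_(i in [set i | B i /\ A j i]) a i
    <= \esum_(i in [set i | B i /\ exists2 j, J j & A j i]) a i.
Proof.
move=> a0 disj.
under eq_esum do rewrite esum_if.
rewrite esum_exchange; last by move=> i j; case: ifP.
rewrite esum_if; apply: le_esum => i Bi.
have -> : \esum_(j in J) (if `[< A j i >] then a i else 0) =
    \esum_(j in [set j | J j /\ A j i]) a i by rewrite esum_if.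
case: asboolP => [[j Jj Aji]|nA]; last first.
  rewrite (_ : [set _ | _] = set0) ?esum_set0//.
  by apply/seteqP; split => j //= [Jj Aji]; apply: nA; exists j.
apply: (@le_trans _ _ (\esum_(j in [set j]) a i)); last by rewrite esum_set1.
apply: esum_subset => k /= [Jk Aki]; exact: disj Aki Aji.
Qed.

Lemma esum_geom (q : R) : (0 <= q < 1)%R ->
  \esum_(d in [set: nat]) (q ^+ d)%:E = ((1 - q)^-1)%:E.
Proof.
move=> /andP[q0 q1].
rewrite -nneseries_esumT; last by move=> d; rewrite lee_fin exprn_ge0.
apply/cvg_lim => //.
have /cvg_geometric_series : (`|q| < 1)%R by rewrite ger0_norm.
move=> /(_ 1%R); rewrite div1r => H.
rewrite (_ : (fun _ => _) = EFin \o series (geometric 1 q)).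
  by apply: cvg_EFin; [exact: nearW|exact: H].
apply/funext => d /=; rewrite sumEFin/= /series/= /geometric/=.
by under [in RHS]eq_bigr do rewrite mul1r.
Qed.

Lemma esum_int_split (k : int) (a : int -> \bar R) : (forall i, 0 <= a i) ->
  \esum_(i in [set: int]) a i =
  \esum_(d in [set: nat]) a (k + d%:Z)%R + \esum_(d in [set: nat]) a (k - d.+1%:Z)%R.
Proof.
move=> a0.
rewrite (esumID [set i | (k <= i)%R])//; congr (_ + _).
- rewrite setTI; apply: reindex_esum; split.
  + by move=> d _ /=; rewrite lerDl.
  + by move=> d e _ _ /addrI [].
  + move=> i /= ki; exists `|i - k|%N => //; lia.
- rewrite setTI; apply: reindex_esum; split.
  + move=> d _ /=; lia.
  + move=> d e _ _; lia.
  + move=> i /= ki; exists `|i - k|.-1%N => //; lia.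
Qed.

Lemma esum_int_shift (k : int) (a : int -> \bar R) :
  \esum_(i in [set: int]) a i = \esum_(i in [set: int]) a (i + k)%R.
Proof.
apply: reindex_esum; split => //.
- by move=> i j _ _ /addIr.
- by move=> i _; exists (i - k)%R => //; rewrite subrK.
Qed.

End Esum.

(** * Volume of a box covered by weighted boxes *)

Section Volume.
Local Open Scope classical_set_scope.
Local Open Scope ring_scope.
Local Open Scope ereal_scope.
Context {R : realType}.

(** Measurability is absent on purpose: the integral of a non-negative function is a supremum over
    the simple functions below it, hence monotone for all integrands. *)
Lemma le_integral_mono (D : set R) (f g : R -> \bar R) :
  (forall x, D x -> 0 <= f x) -> (forall x, D x -> f x <= g x) ->
  \int[@lebesgue_measure R]_(x in D) f x <= \int[@lebesgue_measure R]_(x in D) g x.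
Proof.
move=> f0 fg; rewrite !ge0_integralE//; last first.
  by move=> x Dx; apply: le_trans (fg _ Dx); apply: f0.
apply: ereal_sup_le => x [h hf <-]; exists h => // y.
apply: le_trans (hf y) _; rewrite /patch; case: ifPn => //.
by move=> /set_mem /fg.
Qed.

Lemma lebesgue_itvoc (a l : R) : (0 <= l)%R ->
  @lebesgue_measure R `]a, (a + l)%R] = l%:E.
Proof.
rewrite le_eqVlt => /predU1P[<-|l0]; rewrite lebesgue_measure_itv/= lte_fin.
  by rewrite addr0 ltxx.
by rewrite ltrDl l0 -EFinD addrAC subrr add0r.
Qed.

(* Weights are allowed so that a slice of the covering is again of this form;
   the induction integrates the last coordinate. *)
Lemma weighted_box_volume (n : nat) (a0 : nat -> R) (l0 : R)
    (c : nat -> R) (a : nat -> nat -> R) (l : nat -> R) :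
  (0 <= l0)%R -> (forall i, 0 <= c i)%R -> (forall i, 0 <= l i)%R ->
  (forall x : nat -> R, (forall j, (j < n)%N -> a0 j < x j <= a0 j + l0)%R ->
    1 <= \sum_(i <oo)
       (c i * \prod_(j < n) \1_(`](a i j), (a i j + l i)%R]%classic) (x j))%:E) ->
  (l0 ^+ n)%:E <= \sum_(i <oo) (c i * l i ^+ n)%:E.
Proof.
move=> l00; elim: n c => [|n IH] c c0 ll0 H.
  rewrite expr0; apply: (le_trans (H (fun=> 0%R) _)) => //.
  apply: lee_nneseries => [i _ _|i _]; first by rewrite big_ord0 mulr1 lee_fin.
  by rewrite big_ord0 expr0.
pose D := `]a0 n, (a0 n + l0)%R]%classic.
pose g i y : R := \1_(`](a i n), (a i n + l i)%R]%classic) y.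
have g0 i y : (0 <= g i y)%R by rewrite /g.
have K y : D y -> (l0 ^+ n)%:E <= \sum_(i <oo) ((c i * g i y) * l i ^+ n)%:E.
  move=> Dy; apply: IH => //; first by move=> i; rewrite mulr_ge0.
  move=> x Hx; apply: le_trans (H (fun j => if j == n then y else x j) _) _.
    move=> j; rewrite ltnS leq_eqVlt; case: eqP => [->|_ /=]; last exact: Hx.
    by move: Dy; rewrite /D/= in_itv.
  apply: lee_nneseries => [i _ _|i _].
    by rewrite lee_fin mulr_ge0// prodr_ge0.
  rewrite big_ord_recr/= eqxx -/(g i y) lee_fin.
  under [X in (_ * (X * _) <= _)%R]eq_bigr => j _ do rewrite (ltn_eqF (ltn_ord j)).
  by rewrite -mulrA [(g i y * _)%R]mulrC.
have mD : measurable D by exact: measurable_itv.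
rewrite exprSr EFinM.
rewrite -(lebesgue_itvoc (a0 n) l00) -/D -integral_cst//.
apply: le_trans (le_integral_mono _ K) _.
  by move=> y _; rewrite lee_fin exprn_ge0.
rewrite integral_nneseries//; last first.
- by move=> i y _; rewrite lee_fin !mulr_ge0// exprn_ge0.
- move=> i; apply/measurable_EFinP.
  apply: measurable_funM => //; apply: measurable_funM => //.
  exact: measurable_indic.
apply: lee_nneseries => [i _ _|i _].
  by apply: integral_ge0 => y _; rewrite lee_fin !mulr_ge0// exprn_ge0.
under eq_integral do rewrite mulrAC EFinM.
rewrite ge0_integralZl//; last first.
- by rewrite lee_fin mulr_ge0// exprn_ge0.
- by move=> y _; rewrite lee_fin.
- by apply/measurable_EFinP; exact: measurable_indic.
rewrite exprSr mulrA [leRHS]EFinM; apply: lee_wpmul2l.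
  by rewrite lee_fin mulr_ge0// exprn_ge0.
rewrite integral_indic// -(lebesgue_itvoc (a i n) (ll0 i)).
by apply: le_measure; [apply/mem_set; exact: measurableI|exact/mem_set|exact: subIsetl].
Qed.

End Volume.

(** * Lower bound for the content of a cube *)

Section HausdorffCube.
Local Open Scope classical_set_scope.
Local Open Scope ring_scope.
Local Open Scope ereal_scope.
Context {R : realType} {n : nat}.
Variable delta : R.
Hypothesis hdelta : (0 < delta <= n%:R)%R.

Let coord (v : 'rV[R]_n) (j : nat) : R :=
  if insub j is Some o then v ord0 o else 0%R.

Let coordE (v : 'rV[R]_n) (o : 'I_n) : coord v o = v ord0 o.
Proof. by rewrite /coord insubT//= => p; congr (v _ _); exact: val_inj. Qed.

(** A covering cube of edge larger than [l] pays for everything alone. Otherwise every edge [r] is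
    at most [l], so [delta <= n] gives [(r / l) ^ n <= (r / l) ^ delta], and the volumes of the
    covering cubes add up to at least [l ^ n]. *)
Lemma hausdorff_content_cube_ge (a : 'rV[R]_n) (l : R) : (0 < l)%R ->
  (l `^ delta)%:E <= hausdorff_content delta (cube a l).
Proof.
move=> l0; have /andP[d0 dn] := hdelta.
apply: le_ereal_inf_tmp => _ [D [b [r [r0 sub ->]]]].
have powd0 i : 0 <= (r i `^ delta)%:E by rewrite lee_fin powR_ge0.
have [[i Di ri]|small] := pselect (exists2 i, D i & (l < r i)%R).
  apply: le_trans (esum_ge1 powd0 Di).
  by rewrite lee_fin ge0_ler_powR// ?nnegrE ltW// r0.
have {}small i : D i -> (r i <= l)%R.
  by move=> Di; rewrite leNgt; apply/negP => ?; apply: small; exists i.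
(* Extend the covering to all naturals, with weight zero outside [D]. *)
pose c i : R := if `[< D i >] then 1%R else 0%R.
pose rr i : R := if `[< D i >] then r i else 0%R.
have c0 i : (0 <= c i)%R by rewrite /c; case: ifP.
have rr0 i : (0 <= rr i)%R by rewrite /rr; case: asboolP => // /r0 /ltW.
have : (l ^+ n)%:E <= \sum_(i <oo) (c i * rr i ^+ n)%:E.
  apply: (@weighted_box_volume R n (coord a) l c (fun i => coord (b i))) => //.
    exact: ltW.
  move=> x Hx; rewrite nneseries_esumT; last first.
    by move=> i; rewrite lee_fin mulr_ge0// prodr_ge0.
  have [i Di /= Hi] : (\bigcup_(i in D) cube (b i) (r i)) (\row_(j < n) x j).
    by apply: sub => o /=; rewrite mxE -coordE; exact: Hx.
  apply: le_trans (esum_ge1 (j := i) _ _) => //; last first.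
    by move=> k; rewrite lee_fin mulr_ge0// prodr_ge0.
  rewrite /c asboolT// mul1r big1// => o _.
  rewrite indicE mem_set//= in_itv/= /rr asboolT// coordE.
  by have := Hi o; rewrite mxE.
have ld0 : (0 < l `^ delta)%R by rewrite powR_gt0.
have K0 : (0 < l ^+ n / l `^ delta)%R by rewrite divr_gt0// exprn_gt0.
move=> H; suff : (l ^+ n / l `^ delta)%:E * (l `^ delta)%:E <=
    (l ^+ n / l `^ delta)%:E * \esum_(i in D) (r i `^ delta)%:E.
  by rewrite lee_pmul2l ?lte_fin.
rewrite -EFinM divfK ?gt_eqF//; apply: le_trans H _.
rewrite -(esumZ _ (ltW K0))// esum_mkcond -nneseries_esumT; last first.
  by move=> i; case: ifP => // _; rewrite mule_ge0// lee_fin ltW.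
apply: lee_nneseries => [i _ _|i _].
  by rewrite lee_fin mulr_ge0// exprn_ge0.
rewrite /c /rr; case: asboolP => Di; last by rewrite mul0r memNset.
rewrite mul1r mem_set// -EFinM lee_fin.
have ri0 := r0 _ Di; pose u := (r i / l)%R.
have u0 : (0 < u)%R by rewrite divr_gt0.
have -> : r i = (l * u)%R by rewrite /u mulrCA divff ?mulr1// gt_eqF.
rewrite (powRM _ (ltW l0) (ltW u0)) exprMn.
have -> : (l ^+ n / l `^ delta * (l `^ delta * u `^ delta) = l ^+ n * u `^ delta)%R.
  by field; rewrite gt_eqF.
rewrite ler_pM2l ?exprn_gt0// -(powR_mulrn _ (ltW u0)); apply: ger_powR => //.
by rewrite u0/= ler_pdivrMr// mul1r small.
Qed.

End HausdorffCube.

(** * Integer powers of two *)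

Section Pow2.
Local Open Scope ring_scope.
Context {R : realType}.

Definition pow2 (k : int) : R := 2 ^ k.

Lemma pow2_gt0 k : 0 < pow2 k.
Proof. by rewrite exprz_gt0. Qed.

Lemma pow2_ge0 k : 0 <= pow2 k.
Proof. exact/ltW/pow2_gt0. Qed.

Lemma pow2_neq0 k : pow2 k != 0.
Proof. exact/lt0r_neq0/pow2_gt0. Qed.

Lemma pow2D k m : pow2 (k + m) = pow2 k * pow2 m.
Proof. by rewrite /pow2 expfzDr. Qed.

Lemma pow2N k : pow2 (- k) = (pow2 k)^-1.
Proof. by rewrite /pow2 -invr_expz. Qed.

Lemma pow2_1 : pow2 1 = 2.
Proof. by rewrite /pow2 expr1z. Qed.

Lemma pow2_nat (d : nat) : pow2 d%:Z = 2 ^+ d.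
Proof. by rewrite /pow2 -exprnP. Qed.

Lemma ler_pow2 k m : (pow2 k <= pow2 m) = (k <= m).
Proof. by rewrite /pow2 ler_eXz2l// ltr1n. Qed.

Lemma ltr_pow2 k m : (pow2 k < pow2 m) = (k < m).
Proof. by rewrite /pow2 ltr_eXz2l// ltr1n. Qed.

Lemma pow2_powR k : pow2 k = 2 `^ k%:~R.
Proof. by rewrite powR_intmul. Qed.

Lemma powR2_log (l : R) : 0 < l -> l = 2 `^ (ln l / ln 2).
Proof.
move=> l0; rewrite /powR gt_eqF// divfK ?lnK//.
by rewrite gt_eqF// ln_gt0// ltr1n.
Qed.

Lemma ltr_powR2 (x y : R) : (2 `^ x < 2 `^ y :> R) = (x < y).
Proof. by rewrite /powR gt_eqF// ltr_expR ltr_pM2r// ln_gt0// ltr1n. Qed.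

Lemma ler_powR2 (x y : R) : (2 `^ x <= 2 `^ y :> R) = (x <= y).
Proof. by rewrite !leNgt ltr_powR2. Qed.

Lemma pow2_bracket (l : R) : 0 < l -> exists k, pow2 (k - 1) < l <= pow2 k.
Proof.
move=> l0; exists (Num.ceil (ln l / ln 2)).
have /andP[h1 h2] := ceil_itv (ln l / ln 2).
rewrite !pow2_powR [X in _ < X <= _](powR2_log l0); apply/andP; split.
  by rewrite ltr_powR2.
by rewrite ler_powR2.
Qed.

Lemma pow2_bracket_lt (l : R) : 0 < l -> exists k, pow2 k <= l < pow2 (k + 1).
Proof.
move=> l0; exists (Num.floor (ln l / ln 2)).
have /andP[h1 h2] := floor_itv (ln l / ln 2).
rewrite !pow2_powR [X in _ <= X < _](powR2_log l0); apply/andP; split.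
  by rewrite ler_powR2.
by rewrite ltr_powR2.
Qed.

End Pow2.

(** * The tree of dyadic cubes *)

Section Dyadic.
Local Open Scope classical_set_scope.
Local Open Scope ring_scope.
Context {R : realType} {n : nat}.
Implicit Types (i j : int * {ffun 'I_n -> int}) (x : 'rV[R]_n).

Definition dyadic := (int * {ffun 'I_n -> int})%type.

Definition dcube i : set 'rV[R]_n :=
  cube (\row_o ((i.2 o)%:~R * pow2 i.1)) (pow2 i.1).

(** [ceil - 1] instead of the floor, since the cubes are left-open and right-closed. *)
Definition locate (k : int) x : dyadic :=
  (k, [ffun o => Num.ceil (x ord0 o / pow2 k) - 1]).

Lemma dcubeP i x : dcube i x <-> i = locate i.1 x.
Proof.
split=> [H|->].
  rewrite [LHS]surjective_pairing; congr pair.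
  apply/ffunP => o; rewrite ffunE; apply/eqP; rewrite eq_sym subr_eq.
  rewrite ceil_eq addrK ltr_pdivlMr ?pow2_gt0// ler_pdivrMr ?pow2_gt0//.
  by have := H o; rewrite mxE intrD mulrDl mul1r.
move=> o; rewrite mxE ffunE/=.
have := ceil_itv (x ord0 o / pow2 i.1).
rewrite ltr_pdivlMr ?pow2_gt0// ler_pdivrMr ?pow2_gt0//.
by rewrite intrB mulrBl mul1r subrK.
Qed.

Lemma dcube_locate k x : dcube (locate k x) x.
Proof. exact/dcubeP. Qed.

Definition dparent i : dyadic := (i.1 + 1, [ffun o => (i.2 o %/ 2)%Z]).

Lemma dparent_locate k x : dparent (locate k x) = locate (k + 1) x.
Proof.
congr pair; apply/ffunP => o; rewrite !ffunE.
set y := x ord0 o / pow2 k.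
have -> : x ord0 o / pow2 (k + 1) = y / 2.
  by rewrite pow2D pow2_1 invfM mulrA.
have /andP[h1 h2] := ceil_itv y.
apply/eqP; rewrite eq_sym subr_eq ceil_eq addrK.
move: (Num.ceil y) h1 h2 => m h1 h2.
rewrite ltr_pdivlMr// ler_pdivrMr//.
have := divz_eq (m - 1) 2; have := modz_ge0 (m - 1) (isT : 2 != 0 :> int).
have := ltz_pmod (m - 1) (isT : 0 < 2 :> int).
move: (divz _ _) (modz _ _) => q r r2 r0 e.
apply/andP; split.
  apply: le_lt_trans h1; rewrite -[2]/(2%:~R) -intrM ler_int; lia.
apply: le_trans h2 _; rewrite -[X in _ <= _ * X]/(2%:~R) -intrM ler_int; lia.
Qed.

(** Nesting is encoded by iterated parents, which makes generations computable; [dsub_cube] and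
    [meet_dsub] relate it to the cubes as sets of points. *)
Definition dsub i j := exists s, j = iter s dparent i.

Lemma iter_dparent_locate s k x : iter s dparent (locate k x) = locate (k + s%:Z) x.
Proof.
elim: s => [|s IH]; first by rewrite addr0.
by rewrite iterS IH dparent_locate; congr locate; lia.
Qed.

Lemma gen_iter_dparent s i : (iter s dparent i).1 = i.1 + s%:Z.
Proof. by elim: s => [|s IH]; rewrite ?addr0// iterS/= IH; lia. Qed.

Lemma dsub_refl i : dsub i i. Proof. by exists 0%N. Qed.

Lemma dsub_dparent i : dsub i (dparent i). Proof. by exists 1%N. Qed.

Lemma dsub_trans j i k : dsub i j -> dsub j k -> dsub i k.
Proof. by move=> [s ->] [t ->]; exists (t + s)%N; rewrite iterD. Qed.

Lemma dsub_gen i j : dsub i j -> i.1 <= j.1.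
Proof. by move=> [s ->]; rewrite gen_iter_dparent lerDl. Qed.

Lemma dsub_cube i j : dsub i j -> dcube i `<=` dcube j.
Proof.
move=> [s ->] x /dcubeP ix; apply/dcubeP.
by rewrite gen_iter_dparent {1}ix iter_dparent_locate.
Qed.

Lemma dsub_gen_anti i j : dsub i j -> j.1 <= i.1 -> i = j.
Proof.
move=> [s ->]; rewrite gen_iter_dparent => h.
by have -> : s = 0%N by lia.
Qed.

Lemma dsub_anti i j : dsub i j -> dsub j i -> i = j.
Proof. by move=> ij ji; apply: dsub_gen_anti ij (dsub_gen ji). Qed.

Lemma dsub_strict i j : dsub i j -> i <> j -> dsub (dparent i) j.
Proof.
move=> [[|s]] -> //= _; exists s; by rewrite -iterSr iterS.
Qed.

Lemma meet_dsub i j x : dcube i x -> dcube j x -> i.1 <= j.1 -> dsub i j.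
Proof.
move=> /dcubeP ix /dcubeP jx ij; exists `|j.1 - i.1|%N.
rewrite [LHS]jx [X in iter _ _ X]ix iter_dparent_locate; congr locate; lia.
Qed.

Lemma meet_dsub_total i j x : dcube i x -> dcube j x -> dsub i j \/ dsub j i.
Proof.
move=> ix jx; have [h|/ltW h] := leP i.1 j.1.
  by left; exact: meet_dsub h.
by right; exact: meet_dsub h.
Qed.

Lemma dcube_nonempty i : exists x, dcube i x.
Proof.
exists (\row_o (((i.2 o)%:~R + 1) * pow2 i.1)) => o; rewrite !mxE.
by rewrite mulrDl mul1r lexx andbT ltrDl pow2_gt0.
Qed.

Lemma dsub_total i j k : dsub i j -> dsub i k -> dsub j k \/ dsub k j.
Proof.
move=> ij ik; have [x ix] := dcube_nonempty i.
exact: meet_dsub_total (dsub_cube ij ix) (dsub_cube ik ix).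
Qed.

(** Each strict ascent inside [F] raises the generation, which is bounded by [K]; hence the
    induction on the distance of the generation to [K]. *)
Lemma maximal_dcube (F : set dyadic) i (K : int) : F i ->
  (forall j, F j -> dsub i j -> j.1 <= K) ->
  exists j, [/\ F j, dsub i j & forall k, F k -> dsub j k -> k = j].
Proof.
move=> Fi; move: {2}`|K - i.1|%N (leqnn `|K - i.1|%N) => N.
elim: N i Fi => [|N IH] i Fi hN bnd.
  exists i; split => //; first exact: dsub_refl.
  move=> k Fk ik; apply/esym/dsub_gen_anti => //.
  by have := bnd _ Fk ik; have := bnd _ Fi (dsub_refl i); lia.
have [[k [Fk ik nk]]|nex] := pselect (exists k, [/\ F k, dsub i k & i <> k]).
  have [||j [Fj kj jmax]] := IH k Fk.
  - have := dsub_gen (dsub_strict ik nk) => /=.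
    by have := bnd _ Fk ik; have := bnd _ Fi (dsub_refl i); lia.
  - by move=> j Fj kj; apply: bnd => //; exact: dsub_trans kj.
  by exists j; split => //; exact: dsub_trans kj.
exists i; split => //; first exact: dsub_refl.
by move=> k Fk ik; apply: contrapT => nk; apply: nex; exists k; split => // /esym.
Qed.

(** The concentric cube with three times the edge. *)
Definition triple i : set 'rV[R]_n :=
  cube (\row_o (((i.2 o)%:~R - 1) * pow2 i.1)) (3 * pow2 i.1).

Lemma dcube_triple i : dcube i `<=` triple i.
Proof.
move=> x H o; have := H o; rewrite !mxE.
by have := pow2_gt0 (R := R) i.1; nra.
Qed.

Lemma triple_dsub i j : dsub i j -> triple i `<=` triple j.
Proof.
move=> [s ->]; elim: s => [|s IH]; first by [].
apply: subset_trans IH _; rewrite iterS; move: (iter s dparent i) => {s j} [k m] x H o.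
have /andP[] := H o; rewrite !mxE/= ffunE pow2D pow2_1.
have := divz_eq (m o) 2; have := modz_ge0 (m o) (isT : 2 != 0 :> int).
have := ltz_pmod (m o) (isT : 0 < 2 :> int).
move: (divz _ _) (modz _ _) => q r r2 r0 ->.
have : r%:~R <= 1%:~R :> R by rewrite ler_int; lia.
have : 0%:~R <= r%:~R :> R by rewrite ler_int.
rewrite intrD intrM -[2%:~R]/(2 : R) -[1%:~R]/(1 : R) -[0%:~R]/(0 : R).
have := pow2_gt0 (R := R) k; move: (pow2 k) (x ord0 o) (q%:~R : R) (r%:~R : R).
move=> a y c b a0 b0 b1 h1 h2.
have := mulr_ge0 (ltW a0) b0.
have : 0 <= a * (1 - b) by rewrite mulr_ge0 ?subr_ge0 ?(ltW a0).
by move=> h3 h4; apply/andP; split; lra.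
Qed.

(** An interval of length at most [2 ^ k] meets at most two dyadic intervals of generation [k], and
    these are adjacent; the bits of [b] choose one of the two in each coordinate. *)
Definition corner (k : int) (a : 'rV[R]_n) (b : {ffun 'I_n -> bool}) : dyadic :=
  (k, [ffun o => Num.ceil (a ord0 o / pow2 k) - 1 + (b o)%:Z]).

Lemma cube_sub_corner k a l : l <= pow2 k ->
  cube a l `<=` \bigcup_(b in [set: {ffun 'I_n -> bool}]) dcube (corner k a b).
Proof.
move=> lk x H.
exists [ffun o => (Num.ceil (a ord0 o / pow2 k) * 1)%:~R * pow2 k < x ord0 o] => //.
move=> o; rewrite !mxE !ffunE/= mulr1.
have := ceil_itv (a ord0 o / pow2 k).
rewrite ltr_pdivlMr ?pow2_gt0// ler_pdivrMr ?pow2_gt0//.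
have /andP[] := H o; move: (Num.ceil _) => m; move: (x ord0 o) (a ord0 o) => y z.
rewrite intrB => h1 h2 /andP[h3 h4].
have := pow2_gt0 (R := R) k; move: (pow2 k) lk h1 h2 h3 h4 => p lk h1 h2 h3 h4 p0.
by rewrite intrD intrB; case: (ltP (m%:~R * p) y) => h5 /=; apply/andP; split; lra.
Qed.

Lemma cube_sub_triple k a l b : l <= pow2 k -> cube a l `<=` triple (corner k a b).
Proof.
move=> lk x H o; rewrite !mxE !ffunE/=.
have := ceil_itv (a ord0 o / pow2 k).
rewrite ltr_pdivlMr ?pow2_gt0// ler_pdivrMr ?pow2_gt0//.
have /andP[] := H o; move: (Num.ceil _) => m; move: (x ord0 o) (a ord0 o) => y z.
rewrite intrB => h1 h2 /andP[h3 h4].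
have := pow2_gt0 (R := R) k; move: (pow2 k) lk h1 h2 h3 h4 => p lk h1 h2 h3 h4 p0.
by rewrite intrD intrB; case: (b o) => /=; apply/andP; split; lra.
Qed.

End Dyadic.
Arguments dyadic : clear implicits.

(** * The dyadic content and its comparison with the Hausdorff content *)

Section DyadicContent.
Local Open Scope classical_set_scope.
Local Open Scope ring_scope.
Local Open Scope ereal_scope.
Context {R : realType} {n : nat}.
Variable delta : R.
Hypothesis hdelta : (0 < delta <= n%:R)%R.
Implicit Types (i j : dyadic n) (E F : set 'rV[R]_n).

Definition dcost i : R := (pow2 i.1) `^ delta.

Lemma dcost_gt0 i : (0 < dcost i)%R.
Proof. by rewrite powR_gt0// pow2_gt0. Qed.

Lemma dcost_ge0 i : (0 <= dcost i)%R.
Proof. exact/ltW/dcost_gt0. Qed.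

Lemma dcostE_ge0 i : 0 <= (dcost i)%:E.
Proof. by rewrite lee_fin dcost_ge0. Qed.
Hint Resolve dcostE_ge0 dcost_ge0 dcost_gt0 : core.

Lemma dcost_dparent i : dcost (dparent i) = (2 `^ delta * dcost i)%R.
Proof. by rewrite /dcost/= pow2D pow2_1 mulrC powRM// pow2_ge0. Qed.

Lemma dcost_dsub i j : dsub i j -> (dcost i <= dcost j)%R.
Proof.
move=> /dsub_gen ij; have /andP[d0 _] := hdelta.
by apply: ge0_ler_powR; rewrite ?nnegrE ?pow2_ge0 ?ler_pow2 ?(ltW d0).
Qed.

(** A covering is a set of dyadic cubes instead of a sequence: repetitions only cost more, and
    [dyadic n] is a countable type. *)
Definition dcontent E : \bar R :=
  ereal_inf [set \esum_(i in A) (dcost i)%:E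
            | A in [set A : set (dyadic n) | E `<=` \bigcup_(i in A) dcube i]].

Lemma dcontent_cover E (A : set (dyadic n)) :
  E `<=` \bigcup_(i in A) dcube i -> dcontent E <= \esum_(i in A) (dcost i)%:E.
Proof. by move=> EA; apply: ereal_inf_lbound; exists A. Qed.

Lemma dcontent_lt E x : dcontent E < x ->
  exists2 A : set (dyadic n), E `<=` \bigcup_(i in A) dcube i &
    \esum_(i in A) (dcost i)%:E < x.
Proof. by move=> /ereal_inf_lt [_ [A EA <-] Ax]; exists A. Qed.

Lemma le_dcontent_cover (c : R) E x : (0 < c)%R ->
  (forall A : set (dyadic n), E `<=` \bigcup_(i in A) dcube i ->
    x <= c%:E * \esum_(i in A) (dcost i)%:E) ->
  x <= c%:E * dcontent E.
Proof.
move=> c0 H; rewrite -lee_pdivrMl//; apply: le_ereal_inf_tmp => _ [A EA <-].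
by rewrite lee_pdivrMl//; exact: H.
Qed.

Lemma dcontent_ge0 E : 0 <= dcontent E.
Proof. by apply: le_ereal_inf_tmp => _ [A _ <-]; apply: esum_ge0. Qed.
Hint Resolve dcontent_ge0 : core.

Lemma dcontentS E F : E `<=` F -> dcontent E <= dcontent F.
Proof.
move=> EF; apply: ereal_inf_le_tmp => _ [A FA <-]; exists A => //=.
exact: subset_trans FA.
Qed.

Lemma dcontent_dcube_le i : dcontent (dcube i) <= (dcost i)%:E.
Proof.
rewrite -[leRHS](@esum_set1 R _ i (fun i => (dcost i)%:E))//.
by apply: dcontent_cover => x ix; exists i.
Qed.

Lemma dcontent_bigcup (T : countType) (J : set T) (E : T -> set 'rV[R]_n) :
  dcontent (\bigcup_(t in J) E t) <= \esum_(t in J) dcontent (E t).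
Proof.
have [fin|] := pselect (\esum_(t in J) dcontent (E t) < +oo); last first.
  by move=> /negP; rewrite -leNgt leye_eq => /eqP ->; exact: leey.
apply/lee_addgt0Pr => e e0.
have Efin t : J t -> dcontent (E t) \is a fin_num.
  move=> Jt; rewrite ge0_fin_numE//; apply: le_lt_trans fin.
  exact: (esum_ge1 (a := fun t => dcontent (E t))).
pose eps (t : T) : R := (e * 2^-1 * 2^-1 ^+ pickle t)%R.
have eps0 t : (0 < eps t)%R by rewrite !mulr_gt0// exprn_gt0.
have epsE0 t : 0 <= (eps t)%:E by rewrite lee_fin ltW.
have sumeps : \esum_(t in J) (eps t)%:E <= e%:E.
  have -> : \esum_(t in J) (eps t)%:E =
     \esum_(d in (pickle @` J)) (e * 2^-1 * 2^-1 ^+ d)%:E.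
    by rewrite esum_image// => x y _ _; exact: pcan_inj (@pickleK T) x y.
  apply: le_trans (esum_subset _ (@subsetT _ _)) _.
  under eq_esum do rewrite EFinM.
  rewrite esumZ; last 2 first.
  - by rewrite ltW// mulr_gt0.
  - by move=> d; rewrite lee_fin exprn_ge0.
  rewrite esum_geom; last by rewrite invr_ge0 ler0n invf_lt1 ?ltr1n.
  rewrite -EFinM lee_fin -mulrA -invfM mulrBr mulr1 divff//.
  by rewrite (_ : 2 - 1 = 1)%R ?invr1 ?mulr1//; ring.
have /choice [A HA] : forall t, exists A : set (dyadic n), J t ->
    E t `<=` \bigcup_(i in A) dcube i /\
    \esum_(i in A) (dcost i)%:E <= dcontent (E t) + (eps t)%:E.
  move=> t; have [Jt|nJ] := pselect (J t); last by exists set0.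
  have [|A EA Alt] := @dcontent_lt (E t) (dcontent (E t) + (eps t)%:E).
    by rewrite lteDl ?lte_fin ?Efin.
  by exists A => _; split => //; exact: ltW.
apply: (@le_trans _ _ (\esum_(i in \bigcup_(t in J) A t) (dcost i)%:E)).
  apply: dcontent_cover => x [t Jt Etx].
  by have [/(_ _ Etx) [i Ai ix] _] := HA _ Jt; exists i => //; exists t.
apply: le_trans (esum_bigcup_le _ _ _) _ => //.
apply: (@le_trans _ _ (\esum_(t in J) (dcontent (E t) + (eps t)%:E))).
  by apply: le_esum => t Jt; exact: (HA t Jt).2.
by rewrite esumD//; apply: leeD2l.
Qed.

Lemma dcontentU E F : dcontent (E `|` F) <= dcontent E + dcontent F.
Proof.
have -> : dcontent E + dcontent F =
    \esum_(b in [set: bool]) dcontent (if b then E else F).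
  rewrite (esumID [set true]); last by move=> [] _; exact: dcontent_ge0.
  rewrite !setTI esum_set1//.
  have -> : ~` [set true] = [set false] by apply/seteqP; split => [] [] //= /(_ erefl).
  by rewrite esum_set1.
apply: le_trans (dcontent_bigcup _ _).
by apply: dcontentS => x [?|?]; [exists true|exists false].
Qed.

Lemma hausdorff_le_dcontent E : hausdorff_content delta E <= dcontent E.
Proof.
apply: le_ereal_inf_tmp => _ [A EA <-]; apply: ereal_inf_lbound.
pose i0 : dyadic n := (0, [ffun=> 0])%R.
pose u k : dyadic n := odflt i0 (unpickle k).
exists (pickle @` A), (fun k => \row_o (((u k).2 o)%:~R * pow2 (u k).1)%R),
  (fun k => pow2 (u k).1); split.
- by move=> k _; exact: pow2_gt0.
- by move=> x /EA [i Ai ix]; exists (pickle i); [exists i|rewrite /u pickleK].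
- rewrite esum_image; last by move=> x y _ _; exact: pcan_inj (@pickleK _) x y.
  by apply: eq_esum => i _; rewrite /u pickleK.
Qed.

Lemma dcontent_dcube i : dcontent (dcube i) = (dcost i)%:E.
Proof.
apply/eqP; rewrite eq_le dcontent_dcube_le/=.
apply: le_trans (hausdorff_le_dcontent _).
exact/hausdorff_content_cube_ge/pow2_gt0.
Qed.

(** There are [2 ^ n] corner cubes, each of edge less than twice that of the given cube. *)
Definition ccube : R := (2 ^+ n * 2 `^ delta)%R.

Lemma ccube_gt0 : (0 < ccube)%R.
Proof. by rewrite mulr_gt0// ?exprn_gt0// powR_gt0. Qed.

Lemma esum_fin_const (T : finType) (c : R) : (0 <= c)%R ->
  \esum_(t in [set: T]) c%:E <= (#|T|%:R * c)%:E.
Proof.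
move=> c0; apply: esum_leP => X uX _.
rewrite sumEFin lee_fin big_const_seq count_predT iter_addr_0 -[leLHS]mulr_natl.
rewrite ler_wpM2r// ler_nat.
by rewrite -(card_uniqP uX) max_card.
Qed.

Lemma dcontent_cube_le (a : 'rV[R]_n) (l : R) : (0 < l)%R ->
  dcontent (cube a l) <= (ccube * l `^ delta)%:E.
Proof.
move=> l0; have [k /andP[lk kl]] := pow2_bracket l0.
have /andP[d0 _] := hdelta.
apply: le_trans (dcontentS (cube_sub_corner kl)) _.
apply: le_trans (dcontent_bigcup _ _) _.
apply: (@le_trans _ _ (\esum_(b in [set: {ffun 'I_n -> bool}]) (pow2 k `^ delta)%:E)).
  by apply: le_esum => b _; exact: dcontent_dcube_le.
apply: le_trans (esum_fin_const _ (powR_ge0 _ _)) _.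
rewrite lee_fin card_ffun card_bool card_ord natrX /ccube -mulrA.
rewrite ler_pM2l ?exprn_gt0// -powRM// ?(ltW l0)//.
apply: ge0_ler_powR; rewrite ?nnegrE ?(ltW d0) ?pow2_ge0 ?mulr_ge0 ?(ltW l0)//.
move: lk; rewrite pow2D pow2N pow2_1.
by move=> H; rewrite -ler_pdivrMl// mulrC ltW.
Qed.

Lemma dcontent_le_hausdorff E :
  dcontent E <= ccube%:E * hausdorff_content delta E.
Proof.
rewrite -lee_pdivrMl ?ccube_gt0//.
apply: le_ereal_inf_tmp => _ [D [a [l [l0 sub ->]]]].
rewrite lee_pdivrMl ?ccube_gt0//.
apply: le_trans (dcontentS sub) _; apply: le_trans (dcontent_bigcup _ _) _.
rewrite -esumZ ?(ltW ccube_gt0)//; last by move=> i; rewrite lee_fin powR_ge0.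
by apply: le_esum => k Dk; rewrite -EFinM; apply: dcontent_cube_le; exact: l0.
Qed.

End DyadicContent.

(** * Integrals of nonincreasing functions as dyadic sums *)

Section StepIntegral.
Local Open Scope classical_set_scope.
Local Open Scope ring_scope.
Local Open Scope ereal_scope.
Context {R : realType}.
Local Notation mu := (@lebesgue_measure R).

Lemma esum_countE (T : countType) (f : T -> \bar R) : (forall t, 0 <= f t) ->
  \esum_(t in [set: T]) f t =
  \sum_(i <oo) (if @pickle_inv T i is Some t then f t else 0).
Proof.
move=> f0; rewrite nneseries_esumT; last by move=> i; case: pickle_inv.
transitivity (\esum_(i in range (@pickle T))
    (if @pickle_inv T i is Some t then f t else 0)).
  rewrite esum_image; last by move=> x y _ _; exact: pcan_inj (@pickleK T) x y.
  by apply: eq_esum => t _; rewrite pickleK_inv.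
rewrite esum_mkcond; apply: eq_esum => i _.
case: ifPn => // /negP ni; case E : pickle_inv => [t|] //.
exfalso; apply: ni; apply/mem_set; exists t => //.
by have := @pickle_invK T i; rewrite E.
Qed.

Lemma integral_step (T : countType) (D : set R) (a : T -> \bar R) (J : T -> set R) :
  measurable D -> (forall t, 0 <= a t) -> (forall t, measurable (J t)) ->
  \int[mu]_(x in D) (\esum_(t in [set: T]) (a t * (\1_(J t) x)%:E)) =
  \esum_(t in [set: T]) (a t * mu (J t `&` D)).
Proof.
move=> mD a0 mJ.
have f0 t x : 0 <= a t * (\1_(J t) x)%:E by rewrite mule_ge0// lee_fin.
under eq_integral do rewrite esum_countE//.
rewrite integral_nneseries//; last 2 first.
- move=> i; case: pickle_inv => [t|]//=; apply: measurable_funeM.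
  by apply/measurable_EFinP; apply: measurable_indic; exact: mJ.
- by move=> i x _; case: pickle_inv.
rewrite esum_countE; last by move=> t; rewrite mule_ge0.
apply: eq_eseriesr => i _; case: pickle_inv => [t|]; last exact: integral0.
rewrite ge0_integralZl//.
- by rewrite integral_indic//; exact: mJ.
- by apply/measurable_EFinP; apply: measurable_indic; exact: mJ.
Qed.

Let itv (k : int) : set R := `](pow2 k), (pow2 (k + 1))]%classic.

Let itv_meas k : measurable (itv k).
Proof. exact: measurable_itv. Qed.

Let itv_mu k : mu (itv k `&` `[0%R, +oo[%classic) = (pow2 k)%:E.
Proof.
have e : (pow2 (k + 1) = pow2 k + pow2 k :> R)%R by rewrite pow2D pow2_1; ring.
have -> : itv k `&` `[0%R, +oo[%classic = `](pow2 k), (pow2 k + pow2 k)%R]%classic.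
  apply/seteqP; split => x; rewrite /itv /= !in_itv/= andbT e; first by case.
  by move=> /andP[h1 h2]; rewrite h1 h2 (le_trans (pow2_ge0 k) (ltW h1)).
by rewrite lebesgue_itvoc// pow2_ge0.
Qed.

Let itv_inj j k x : itv j x -> itv k x -> j = k.
Proof.
rewrite /itv/= !in_itv/= => /andP[h1 h2] /andP[h3 h4].
have : (pow2 j < pow2 (k + 1) :> R)%R by exact: lt_le_trans h4.
have : (pow2 k < pow2 (j + 1) :> R)%R by exact: lt_le_trans h2.
rewrite !ltr_pow2; lia.
Qed.

Variable phi : R -> \bar R.
Hypothesis phi0 : forall t, (0 <= t)%R -> 0 <= phi t.
Hypothesis phi_ni : forall s t, (0 <= s)%R -> (s <= t)%R -> phi t <= phi s.

Lemma integral_le_dyadic_sum :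
  \int[mu]_(t in `[0%R, +oo[) phi t <= \esum_(k in [set: int]) ((pow2 k)%:E * phi (pow2 k)).
Proof.
(* The index [None] stands for the point 0, which lies in no interval [itv k]; the value [+oo] there
   is harmless because a point is null. *)
pose a (o : option int) := if o is Some k then phi (pow2 k) else +oo.
pose J (o : option int) := if o is Some k then itv k else [set 0%R].
have a0 o : 0 <= a o by case: o => //= k; apply: phi0; exact: pow2_ge0.
have mJ o : measurable (J o) by case: o => //=.
have t0 o x : 0 <= a o * (\1_(J o) x)%:E by rewrite mule_ge0// lee_fin.
apply: (@le_trans _ _ (\int[mu]_(x in `[0%R, +oo[)
   (\esum_(o in [set: option int]) (a o * (\1_(J o) x)%:E)))).
  apply: le_integral_mono => x /=; rewrite in_itv/= andbT => x0; first exact: phi0.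
  move: x0; rewrite le_eqVlt => /predU1P[<-|x0].
    apply: le_trans (esum_ge1 (j := None) _ _) => //=.
    by rewrite indicE mem_set// mule1 leey.
  have [k /andP[k1 k2]] := pow2_bracket x0.
  apply: le_trans (esum_ge1 (j := Some (k - 1)%R) _ _) => //=.
  rewrite indicE mem_set ?mule1; last by rewrite /itv/= in_itv/= subrK k1.
  by apply: phi_ni; [exact: pow2_ge0|exact: ltW].
rewrite integral_step//.
rewrite (esumID [set None]); last by move=> o _; rewrite mule_ge0.
rewrite setTI (@esum_set1 _ _ None (fun o => a o * _))/=; last by rewrite mule_ge0.
rewrite (_ : mu _ = 0) ?mule0 ?add0e; last first.
  apply/eqP; rewrite eq_le measure_ge0 andbT.
  rewrite -(lebesgue_measure_set1 (0%R : R)); apply: le_measure; rewrite ?inE//=.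
  exact: measurableI.
rewrite (_ : _ `&` _ = Some @` [set: int]); last first.
  apply/seteqP; split => [[k|] /= [_ H]|_ [k _ <-]] //; by exists k.
rewrite esum_image; last by move=> x y _ _ [].
by apply: le_esum => k _ /=; rewrite itv_mu muleC.
Qed.

(** On [itv k] the function is at least its value at the right end [2 ^ (k + 1)], while the length
    is only [2 ^ k]: this shift is the factor 2. *)
Lemma dyadic_sum_le_integral :
  \esum_(k in [set: int]) ((pow2 k)%:E * phi (pow2 k))
    <= 2%:E * \int[mu]_(t in `[0%R, +oo[) phi t.
Proof.
pose a k := phi (pow2 (k + 1)).
have a0 k : 0 <= a k by apply: phi0; exact: pow2_ge0.
have t0 k x : 0 <= a k * (\1_(itv k) x)%:E by rewrite mule_ge0// lee_fin.
rewrite (@esum_int_shift _ 1).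
have -> : \esum_(i in [set: int]) ((pow2 (i + 1))%:E * phi (pow2 (i + 1))) =
    2%:E * \esum_(k in [set: int]) (a k * mu (itv k `&` `[0%R, +oo[%classic)).
  rewrite -esumZ//; last by move=> k; rewrite mule_ge0.
  apply: eq_esum => k _; rewrite itv_mu /a; move: (phi _) => y.
  by rewrite pow2D pow2_1 EFinM [y * _]muleC muleA [2%:E * _]muleC.
apply: lee_wpmul2l => //; rewrite -integral_step//.
apply: le_integral_mono => x /=; rewrite in_itv/= andbT => x0.
  exact: esum_ge0.
have [[k kx]|nk] := pselect (exists k, itv k x); last first.
  rewrite esum1; first exact: phi0.
  move=> k _; rewrite indicE memNset ?mule0// => kx; apply: nk; by exists k.
apply: (@le_trans _ _ (a k * (\1_(itv k) x)%:E)); last first.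
  rewrite indicE mem_set// mule1; apply: phi_ni => //.
  by move: kx; rewrite /itv/= in_itv/= => /andP[].
rewrite (esumID [set k]) // !setTI esum_set1// (esum1 (D := ~` [set k])) ?adde0//.
move=> j jk; rewrite indicE memNset ?mule0// => jx; apply: jk; exact: itv_inj jx kx.
Qed.

End StepIntegral.

(** * The discretised Choquet integral *)

Section DyadicChoquet.
Local Open Scope classical_set_scope.
Local Open Scope ring_scope.
Local Open Scope ereal_scope.
Context {R : realType} {n : nat}.
Variable delta : R.
Hypothesis hdelta : (0 < delta <= n%:R)%R.
Implicit Types (i j : dyadic n) (E F : set 'rV[R]_n) (g : 'rV[R]_n -> \bar R).
Local Notation h := (dcontent delta).
Hint Resolve dcontent_ge0 : core.

(* The Choquet integral of the dyadic content, discretised along the powers of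
   two; it is comparable to [choquet] and needs no measurability. *)
Definition dchoquet E g : \bar R :=
  \esum_(k in [set: int]) ((pow2 k)%:E * h [set x | E x /\ (pow2 k)%:E < g x]).
Local Notation I := dchoquet.

Lemma pow2E_ge0 k : 0 <= (pow2 k : R)%:E.
Proof. by rewrite lee_fin pow2_ge0. Qed.
Hint Resolve pow2E_ge0 : core.

Lemma dterm_ge0 k E : 0 <= (pow2 k)%:E * h E.
Proof. by rewrite mule_ge0. Qed.
Hint Resolve dterm_ge0 : core.

Lemma dchoquet_ge0 E g : 0 <= I E g.
Proof. exact: esum_ge0. Qed.
Hint Resolve dchoquet_ge0 : core.

Lemma le_dchoquet E F g g' : E `<=` F -> (forall x, E x -> g x <= g' x) ->
  I E g <= I F g'.
Proof.
move=> EF gg; apply: le_esum => k _; apply: lee_wpmul2l => //.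
by apply: dcontentS => x /= [Ex gx]; split; [exact: EF|exact: lt_le_trans (gg _ Ex)].
Qed.

Lemma dchoquetS E F g : E `<=` F -> I E g <= I F g.
Proof. by move=> EF; exact: le_dchoquet. Qed.

Lemma dchoquet_bigcup (T : countType) (J : set T) (E : T -> set 'rV[R]_n) g :
  I (\bigcup_(t in J) E t) g <= \esum_(t in J) I (E t) g.
Proof.
rewrite esum_exchange//; apply: le_esum => k _.
rewrite esumZ ?pow2_ge0//; apply: lee_wpmul2l => //.
apply: le_trans (dcontent_bigcup _ _ _).
by apply: dcontentS => x /= [[t Jt Ex] gx]; exists t.
Qed.

Lemma dchoquet_term E g k :
  (pow2 k)%:E * h [set x | E x /\ (pow2 k)%:E < g x] <= I E g.
Proof. exact: (esum_ge1 (a := fun k => (pow2 k)%:E * h [set x | E x /\ (pow2 k)%:E < g x])). Qed.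

(** The factor 2 pays for replacing [t] by the largest power of two strictly below it; strictness
    lets the set be defined by [t <= g]. *)
Lemma dchoquet_markov E g (t : R) : (0 < t)%R ->
  t%:E * h [set x | E x /\ t%:E <= g x] <= 2%:E * I E g.
Proof.
move=> t0; have [k /andP[k1 k2]] := pow2_bracket t0.
have t2 : (t <= 2 * pow2 (k - 1))%R.
  by move: k2; rewrite pow2D pow2N pow2_1 mulrCA divff ?mulr1.
apply: (@le_trans _ _ ((2 * pow2 (k - 1))%:E * h [set x | E x /\ t%:E <= g x])).
  by apply: lee_wpmul2r => //; exact: dcontent_ge0.
rewrite EFinM -muleA; apply: lee_wpmul2l => //.
apply: le_trans (dchoquet_term E g (k - 1)%R).
apply: lee_wpmul2l => //; apply: dcontentS => x /= [Ex gx]; split => //.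
by apply: lt_le_trans gx; rewrite lte_fin.
Qed.

Lemma dchoquet_tail E g k :
  \esum_(j in [set j | (k <= j)%R]) ((pow2 j)%:E * h [set x | E x /\ (pow2 j)%:E < g x])
  <= I [set x | E x /\ (pow2 k)%:E < g x] g.
Proof.
apply: le_trans (esum_subset _ (@subsetT _ _)).
apply: le_esum => j /= kj; apply: lee_wpmul2l => //.
apply: dcontentS => x /= [Ex gx]; split => //; split => //.
by apply: le_lt_trans gx; rewrite lee_fin ler_pow2.
Qed.

Lemma hausdorff_content_ge0 E : 0 <= hausdorff_content delta E.
Proof.
apply: le_ereal_inf_tmp => _ [D [a [l [_ _ ->]]]].
by apply: esum_ge0 => i _; rewrite lee_fin powR_ge0.
Qed.

Lemma hausdorff_contentS E F : E `<=` F ->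
  hausdorff_content delta E <= hausdorff_content delta F.
Proof.
move=> EF; apply: ereal_inf_le_tmp => _ [D [a [l [l0 sub ->]]]].
by exists D, a, l; split => //; exact: subset_trans sub.
Qed.

Lemma choquet_le_dchoquet E g : choquet delta E g <= I E g.
Proof.
apply: le_trans (integral_le_dyadic_sum _ _) _.
- by move=> t _; exact: hausdorff_content_ge0.
- move=> s t s0 st; apply: hausdorff_contentS => x /= [Ex gx]; split => //.
  by apply: le_lt_trans gx; rewrite lee_fin.
- by apply: le_esum => k _; apply: lee_wpmul2l => //; exact: hausdorff_le_dcontent.
Qed.

Definition cchoquet : R := (2 * @ccube R n delta)%R.

Lemma cchoquet_gt0 : (0 < cchoquet)%R.
Proof. by rewrite mulr_gt0// ccube_gt0. Qed.

Lemma dchoquet_le_choquet E g : I E g <= cchoquet%:E * choquet delta E g.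
Proof.
pose phi (t : R) := hausdorff_content delta [set x | E x /\ t%:E < g x].
apply: (@le_trans _ _ (((@ccube R n delta))%:E *
    \esum_(k in [set: int]) ((pow2 k)%:E * phi (pow2 k)))).
  rewrite -esumZ; last 2 first.
  - exact/ltW/ccube_gt0.
  - by move=> k; rewrite mule_ge0// hausdorff_content_ge0.
  apply: le_esum => k _; rewrite muleCA; apply: lee_wpmul2l => //.
  exact: dcontent_le_hausdorff.
have -> : cchoquet%:E * choquet delta E g =
    (@ccube R n delta)%:E * (2%:E * choquet delta E g).
  by rewrite muleA -EFinM /cchoquet [(2 * _)%R]mulrC.
apply: lee_wpmul2l.
  by rewrite lee_fin; exact/ltW/ccube_gt0.
apply: dyadic_sum_le_integral.
- by move=> t _; exact: hausdorff_content_ge0.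
- move=> s t s0 st; apply: hausdorff_contentS => x /= [Ex gx]; split => //.
  by apply: le_lt_trans gx; rewrite lee_fin.
Qed.

Lemma choquet_ge0 E g : 0 <= choquet delta E g.
Proof. by apply: integral_ge0 => t _; exact: hausdorff_content_ge0. Qed.

End DyadicChoquet.

(** * From medians to geometric decay *)

Section SelfImprovement.
Local Open Scope classical_set_scope.
Local Open Scope ring_scope.
Local Open Scope ereal_scope.
Context {R : realType} {n : nat}.
Variable delta : R.
Hypothesis hdelta : (0 < delta <= n%:R)%R.
Implicit Types (P Q : dyadic n) (E F : set 'rV[R]_n) (g : 'rV[R]_n -> \bar R).
Local Notation h := (dcontent delta).
Local Notation I := (dchoquet delta).
Local Notation dcost := (dcost delta).

Lemma esum_setU_le (T : choiceType) (A B : set T) (a : T -> \bar R) :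
  (forall t, 0 <= a t) ->
  \esum_(t in A `|` B) a t <= \esum_(t in A) a t + \esum_(t in B) a t.
Proof.
move=> a0; rewrite (esumID A)//; apply: leeD; apply: esum_subset => x /=.
  by move=> [].
by move=> [[|]].
Qed.

(** A median of [g] on a dyadic cube is at least its average up to a factor of order [2 ^ m]. *)
Definition median_bound (m : nat) g := forall Q k,
  (pow2 (k + m%:Z) * dcost Q)%:E < I (dcube Q) g ->
  (dcost Q)%:E <= 2%:E * h [set x | dcube Q x /\ (pow2 k)%:E < g x].

(* In a covering of the superlevel set of [g], replace the cubes lying below a
   maximal cube of large average by that maximal cube: the median bound shows
   that this at most triples the cost, and afterwards no average is large. *)
Lemma reverse_weak_type g m Q0 k : median_bound m g ->
  I (dcube Q0) g <= (pow2 (k + m%:Z) * dcost Q0)%:E ->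
  I [set x | dcube Q0 x /\ (pow2 k)%:E < g x] g
    <= (3 * 2 `^ delta * pow2 (k + m%:Z))%:E
       * h [set x | dcube Q0 x /\ (pow2 k)%:E < g x].
Proof.
move=> med avg0; set F := [set x | _ /\ _]; set lam : R := pow2 (k + m%:Z).
have /andP[d0 _] := hdelta.
have lam0 : (0 < lam)%R by exact: pow2_gt0.
have d1 : (1 <= 2 `^ delta :> R)%R.
  by have := ler_powR2 (0 : R) delta; rewrite powRr0 => ->; exact: ltW.
have dp0 : (0 < 2 `^ delta :> R)%R by exact: lt_le_trans d1.
have FQ0 : F `<=` dcube Q0 by move=> x [].
apply: le_dcontent_cover; first by rewrite !mulr_gt0.
move=> A FA.
(* If a covering cube contains [Q0], the bound on the average over [Q0] already suffices; otherwise
   all covering cubes that meet [Q0] lie inside it. *)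
have [[P AP Q0P]|noP] := pselect (exists2 P, A P & dsub Q0 P).
  apply: le_trans (dchoquetS _ _ FQ0) _; apply: le_trans avg0 _.
  apply: (@le_trans _ _ ((3 * 2 `^ delta * lam)%:E * (dcost P)%:E)).
    rewrite -EFinM lee_fin; apply: ler_pM; rewrite ?(ltW lam0) ?dcost_ge0//.
      by rewrite ler_peMl ?(ltW lam0)//; move: d1; move: (2 `^ delta)%R => d; lra.
    exact: dcost_dsub.
  apply: lee_wpmul2l; first by rewrite lee_fin ltW// !mulr_gt0.
  by apply: (esum_ge1 (a := fun i => (dcost i)%:E)) => // i; rewrite lee_fin dcost_ge0.
have AQ0 P (x : 'rV[R]_n) : A P -> dcube P x -> dcube Q0 x -> dsub P Q0.
  move=> AP Px Q0x; have [//|PQ0] := meet_dsub_total Px Q0x.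
  by exfalso; apply: noP; exists P.
pose B : set (dyadic n) :=
  [set Q | dsub Q Q0 /\ (lam * dcost Q)%:E < I (dcube Q) g].
have nB Q : dsub Q Q0 -> ~ B Q -> I (dcube Q) g <= (lam * dcost Q)%:E.
  by move=> QQ0 nBQ; rewrite leNgt; apply/negP => ?; apply: nBQ.
pose Bmax Q := B Q /\ forall Q', B Q' -> dsub Q Q' -> Q' = Q.
(* [A1] keeps the covering cubes of [Q0] that lie below no cube of large average; [A2] adds the
   maximal cubes of large average that are not strictly inside a covering cube. *)
pose A1 := [set P | A P /\ (dsub P Q0 /\ forall Q, B Q -> ~ dsub P Q)].
pose A2 := [set Q | Bmax Q /\ forall P, A P -> dsub Q P -> P = Q].
have cover : F `<=` \bigcup_(i in A1 `|` A2) dcube i.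
  move=> x Fx; have [P AP Px] := FA _ Fx.
  have PQ0 := AQ0 _ _ AP Px (FQ0 _ Fx).
  have [[Q BQ PQ]|nBP] := pselect (exists2 Q, B Q & dsub P Q); last first.
    by exists P => //; left; split => //; split => // Q BQ PQ; apply: nBP; exists Q.
  have [Q1 [BQ1 QQ1 Q1max]] : exists Q1, [/\ B Q1, dsub Q Q1 &
      forall Q', B Q' -> dsub Q1 Q' -> Q' = Q1].
    by apply: (@maximal_dcube _ _ _ Q0.1) => // j [/dsub_gen].
  have Q1x : dcube Q1 x by apply: (dsub_cube (dsub_trans PQ QQ1)).
  have [[P' [AP' Q1P' nP']]|none] :=
    pselect (exists P', [/\ A P', dsub Q1 P' & P' <> Q1]); last first.
    exists Q1 => //; right; split => // P' AP' Q1P'.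
    by apply: contrapT => ?; apply: none; exists P'.
  have P'x : dcube P' x by exact: (dsub_cube Q1P').
  exists P' => //; left; split => //; split; first exact: AQ0 P'x (FQ0 _ Fx).
  move=> Q' BQ' P'Q'; apply: nP'; apply: dsub_anti => //.
  by rewrite -(Q1max _ BQ' (dsub_trans Q1P' P'Q')).
have avgA1 P : A1 P -> I (dcube P) g <= (2 `^ delta * lam)%:E * (dcost P)%:E.
  move=> [AP [PQ0 nBP]]; apply: le_trans (nB _ PQ0 _) _.
    by move=> BP; apply: nBP BP (dsub_refl _).
  by rewrite -EFinM lee_fin ler_pM2r ?dcost_gt0// ler_peMl// ltW.
(* A maximal cube of large average is not [Q0], so its parent is still inside [Q0] and has a small
   average; passing to the parent costs [2 ^ delta]. *)
have avgA2 Q : A2 Q -> I (dcube Q) g <= (2 `^ delta * lam)%:E * (dcost Q)%:E.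
  move=> [[[QQ0 avgQ] Qmax] _].
  have QnQ0 : Q <> Q0 by move=> e; move: avgQ; rewrite e ltNge avg0.
  have pQQ0 := dsub_strict QQ0 QnQ0.
  apply: le_trans (dchoquetS _ _ (dsub_cube (dsub_dparent Q))) _.
  apply: le_trans (nB _ pQQ0 _) _.
    move=> BpQ; have := Qmax _ BpQ (dsub_dparent Q) => /(congr1 fst) /=; lia.
  by rewrite dcost_dparent -EFinM lee_fin mulrCA mulrA.
have len0 P : 0 <= (dcost P)%:E by rewrite lee_fin dcost_ge0.
apply: le_trans (dchoquetS _ _ cover) _.
apply: le_trans (dchoquet_bigcup _ _ _ _) _.
apply: (@le_trans _ _ (\esum_(i in A1 `|` A2) ((2 `^ delta * lam)%:E * (dcost i)%:E))).
  by apply: le_esum => i [/avgA1|/avgA2].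
rewrite esumZ//; last by rewrite ltW// mulr_gt0.
have -> : (3 * 2 `^ delta * lam = (2 `^ delta * lam) * 3)%R by ring.
rewrite [(_ * 3)%:E]EFinM -muleA; apply: lee_wpmul2l.
  by rewrite lee_fin ltW// mulr_gt0.
apply: le_trans (esum_setU_le _ _ _) _ => //.
set s := \esum_(i in A) _.
have -> : (3%:E * s = s + 2%:E * s)%E.
  have -> : 3%:E = 1%:E + 2%:E :> \bar R by rewrite -EFinD; congr EFin; ring.
  by rewrite ge0_muleDl ?lee_fin// mul1e.
apply: leeD; first by apply: esum_subset => P [].
(* By the median bound, a cube of [A2] costs at most twice the covering cubes inside it. Cubes of
   [A2] are pairwise not nested, so these subfamilies of [A] are disjoint and the total is at most
   twice the cost of [A]. *)
apply: (@le_trans _ _ (\esum_(Q in A2) (2%:E *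
    \esum_(P in [set P | A P /\ dsub P Q]) (dcost P)%:E))).
  apply: le_esum => Q [[[QQ0 avgQ] Qmax] QA].
  apply: le_trans (med _ _ avgQ) _; apply: lee_wpmul2l => //.
  apply: dcontent_cover => x [Qx gx].
  have [P AP Px] : (\bigcup_(i in A) dcube i) x.
    by apply: FA; split => //; exact: dsub_cube Qx.
  exists P => //; split => //.
  have [//|QP] := meet_dsub_total Px Qx.
  by rewrite (QA _ AP QP); exact: dsub_refl.
rewrite esumZ//; last by move=> Q; apply: esum_ge0.
apply: lee_wpmul2l => //.
apply: le_trans (esum_disjoint_le _ _ _) _ => //; last first.
  by apply: esum_subset => P [].
move=> Q Q' P [[BQ Qmax] _] [[BQ' Q'max] _] PQ PQ'.
have [QQ'|Q'Q] := dsub_total (R := R) PQ PQ'; first by rewrite (Qmax _ BQ' QQ').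
by rewrite (Q'max _ BQ Q'Q).
Qed.

(** With [a j] the term of level [2 ^ j] and [T j] the tail from it on, the previous lemma reads
    [T j <= C * a j = C * (T j - T (j + 1))], so the tail shrinks by [1 - 1 / C] at each level. The
    factor [2 ^ (- r)] alone would be the decay given by Markov's inequality. *)
Lemma median_bound_decay (m : nat) : exists2 theta : R, (0 < theta < 1)%R &
  forall g, median_bound m g -> forall Q k (r : nat),
    I (dcube Q) g <= (pow2 k * dcost Q)%:E ->
    h [set x | dcube Q x /\ (pow2 (k + r%:Z))%:E < g x]
      <= (theta ^+ r * 2^-1 ^+ r * dcost Q)%:E.
Proof.
have /andP[d0 _] := hdelta.
pose C : R := (3 * 2 `^ delta * 2 ^+ m)%R.
have C1 : (1 < C)%R.
  have d1 : (1 <= 2 `^ delta :> R)%R.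
  by have := ler_powR2 (0 : R) delta; rewrite powRr0 => ->; exact: ltW.
  have m1 : (1 <= 2 ^+ m :> R)%R by rewrite exprn_ege1// ler1n.
  by rewrite /C; nra.
have C0 : (0 < C)%R by exact: lt_trans C1.
exists (1 - C^-1)%R.
  by rewrite subr_gt0 invf_lt1// C1/= ltrBlDr ltrDl invr_gt0.
move=> g med Q k r avg.
set theta := (1 - C^-1)%R.
have th0 : (0 < theta)%R by rewrite subr_gt0 invf_lt1.
have th1 : (theta <= 1)%R by rewrite lerBlDr lerDl invr_ge0 ltW.
pose a j : \bar R := (pow2 j)%:E * h [set x | dcube Q x /\ (pow2 j)%:E < g x].
have a0 j : 0 <= a j by exact: dterm_ge0.
pose T j := \esum_(i in [set i | (j <= i)%R]) a i.
have T0 j : 0 <= T j by exact: esum_ge0.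
have TI j : T j <= I (dcube Q) g by exact: esum_subset.
have Tfin j : T j \is a fin_num.
  by rewrite ge0_fin_numE// (le_lt_trans (TI j))// (le_lt_trans avg)// ltry.
have afin j : a j \is a fin_num.
  rewrite ge0_fin_numE// (le_lt_trans (esum_ge1 (a := a) (A := setT) _ _))//.
  by rewrite (le_lt_trans avg)// ltry.
have TS j : T j = a j + T (j + 1)%R.
  rewrite /T (esumID [set j])//; congr (_ + _).
    rewrite (_ : _ `&` _ = [set j]) ?esum_set1//.
    by apply/seteqP; split => i /=; [case|move=> ->].
  congr esum; apply/seteqP; split => i /=.
    by move=> [h1 h2]; have /eqP := h2; lia.
  by move=> ji; split; [lia|move=> e; move: ji; rewrite e; lia].
have step j : (k - m%:Z <= j)%R -> T j <= C%:E * a j.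
  move=> kj; apply: le_trans (dchoquet_tail _ _ _ _) _.
  apply: le_trans (reverse_weak_type (m := m) _ _) _ => //.
    apply: le_trans avg _; rewrite lee_fin ler_pM2r ?dcost_gt0//.
    by rewrite ler_pow2; lia.
  rewrite /a muleA -EFinM /C pow2D pow2_nat.
  by rewrite -!mulrA [(pow2 j * _)%R]mulrC.
have contract j : (k - m%:Z <= j)%R -> T (j + 1)%R <= theta%:E * T j.
  move=> kj; have := step _ kj; have := TS j.
  rewrite -(fineK (Tfin j)) -(fineK (Tfin (j + 1)%R)) -(fineK (afin j)).
  rewrite -EFinM -EFinD -EFinM !lee_fin => -[->].
  move: (fine (a j)) (fine (T (j + 1)%R)) => u v uv.
  rewrite /theta mulrBl mul1r lerBrDr [leRHS]addrC lerD2l.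
  by rewrite ler_pdivrMl.
(* The iteration may start at level [k - m], the lowest one for which the average over [Q] meets the
   hypothesis; the resulting extra factor [theta ^ m] is dropped at the end. *)
have iterT s : T (k - m%:Z + s%:Z)%R <= (theta ^+ s * (pow2 k * dcost Q))%:E.
  elim: s => [|s IH]; first by rewrite addr0 expr0 mul1r (le_trans (TI _)).
  have -> : (k - m%:Z + s.+1%:Z = k - m%:Z + s%:Z + 1)%R by lia.
  apply: le_trans (contract _ _) _; first by lia.
  rewrite exprS -mulrA [leRHS]EFinM; apply: lee_wpmul2l => //.
  by rewrite lee_fin ltW.
have aT : a (k + r%:Z)%R <= T (k + r%:Z)%R by apply: (esum_ge1 (a := a)) => /=.
have := iterT (r + m)%N; rewrite (_ : (_ + _ = k + r%:Z)%R); last by lia.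
move=> /(le_trans aT); rewrite /a -lee_pdivlMl ?pow2_gt0//.
move=> /le_trans; apply; rewrite -EFinM lee_fin.
rewrite pow2D pow2_nat exprD invfM exprVn.
have -> : ((pow2 k)^-1 / 2 ^+ r * (theta ^+ r * theta ^+ m * (pow2 k * dcost Q)) =
   theta ^+ m * (theta ^+ r / 2 ^+ r * dcost Q))%R.
  by field; rewrite pow2_neq0 expf_neq0.
rewrite ler_piMl//; last exact: exprn_ile1 (ltW th0) th1.
by rewrite mulr_ge0 ?dcost_ge0// divr_ge0// exprn_ge0// ltW.
Qed.

End SelfImprovement.

(** * Median bounds from the Muckenhoupt condition *)

Section Muckenhoupt.
Local Open Scope classical_set_scope.
Local Open Scope ring_scope.
Local Open Scope ereal_scope.
Context {R : realType} {n : nat}.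
Variable delta : R.
Hypothesis hdelta : (0 < delta <= n%:R)%R.
Implicit Types (P Q : dyadic n) (E F : set 'rV[R]_n) (u v w g : 'rV[R]_n -> \bar R).
Local Notation h := (dcontent delta).
Local Notation I := (dchoquet delta).
Local Notation dcost := (dcost delta).
Hint Resolve dcontent_ge0 dchoquet_ge0 : core.

Lemma powR2D (x y : R) : (2 `^ (x + y) = 2 `^ x * 2 `^ y :> R)%R.
Proof. by rewrite powRD// pnatr_eq0 implybT. Qed.

Lemma powR_exprn (a x : R) (r : nat) : (0 <= a)%R ->
  ((a ^+ r) `^ x = (a `^ x) ^+ r)%R.
Proof.
move=> a0; rewrite -(powR_mulrn _ a0) -(powR_mulrn _ (powR_ge0 _ _)).
by rewrite -!powRrM mulrC.
Qed.

Lemma expr_unbounded (x M : R) : (1 < x)%R -> exists m : nat, (M <= x ^+ m)%R.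
Proof.
move=> x1; have x0 : (0 < x - 1)%R by rewrite subr_gt0.
have bern (m : nat) : (1 + m%:R * (x - 1) <= x ^+ m)%R.
  elim: m => [|m IH]; first by rewrite mul0r addr0 expr0.
  rewrite exprS; apply: le_trans (ler_wpM2l (ltW (lt_trans ltr01 x1)) IH).
  have m0 : (0 <= m%:R * ((x - 1) * (x - 1)) :> R)%R.
    by rewrite mulr_ge0 ?ler0n// mulr_ge0// ltW.
  by rewrite -natr1; lra.
exists (Num.bound (`|M| / (x - 1))); apply: le_trans (bern _).
have : (`|M| / (x - 1) < (Num.bound (`|M| / (x - 1)))%:R)%R.
  by rewrite archi_boundP// divr_ge0// ltW.
rewrite ltr_pdivrMr// => /ltW H; have := ler_norm M; lra.
Qed.

Lemma expr_small (x c e : R) : (0 < x < 1)%R -> (0 < e)%R ->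
  exists m : nat, (c * x ^+ m <= e)%R.
Proof.
move=> /andP[x0 x1] e0; have ix1 : (1 < x^-1)%R by rewrite invf_gt1.
have [m hm] := expr_unbounded (c / e) ix1; exists m.
by move: hm; rewrite exprVn ler_pdivrMr// mulrC ler_pdivlMr ?exprn_gt0.
Qed.

(* [v >= u ^ (- q)], where [0 ^ (- q)] is [+oo] and [+oo ^ (- q)] is [0]. *)
Definition dual_weight (q : R) u v := forall x (t : R), (0 < t)%R ->
  u x <= t%:E -> (t `^ (- q))%:E <= v x.

(** Where [u <= t], the dual weight is at least [t ^ (- q)]; Markov's inequality for [v] and the
    bound on [b * a ^ q] make this set occupy at most half of [Q], and subadditivity leaves the
    other half. The form is symmetric, so that it applies to [sigma] with exponent [p - 1] and to
    [w] with exponent [1 / (p - 1)]. *)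
Lemma median_bound_Ap (q A : R) u v : (0 < q)%R -> (0 < A)%R ->
  dual_weight q u v ->
  (forall Q, exists a b : R, [/\ (0 < a)%R, I (dcube Q) u = a%:E,
     I (dcube Q) v = b%:E & (b * a `^ q <= A * dcost Q `^ (1 + q))%R]) ->
  exists m, median_bound delta m u.
Proof.
move=> q0 A0 dual Ap.
have p1 : (1 < 2 `^ q :> R)%R by rewrite -[X in (X < _)%R](powRr0 2) ltr_powR2.
(* One factor 2 comes from Markov's inequality, the other from the half to be reached. *)
have [m hm] := expr_unbounded (4 * A) p1.
exists m => Q k; have [a [b [a0 -> Iv ab]]] := Ap Q.
rewrite lte_fin => avg.
set t : R := pow2 k; have t0 : (0 < t)%R by exact: pow2_gt0.
set l := dcost Q in ab avg *; have l0 : (0 < l)%R by exact: dcost_gt0.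
set G := [set x | _ /\ _]; pose B := [set x | dcube Q x /\ (t `^ (- q))%:E <= v x].
have tq0 : (0 < t `^ (- q))%R by rewrite powR_gt0.
have hB : h B <= (l / 2)%:E.
  have := dchoquet_markov delta (dcube Q) v tq0.
  rewrite -lee_pdivlMl// => /le_trans; apply.
  rewrite Iv -!EFinM lee_fin.
  have s0 : (0 < t * 2 ^+ m * l)%R by rewrite !mulr_gt0// exprn_gt0.
  have sa : ((t * 2 ^+ m * l) `^ q <= a `^ q)%R.
    apply: ge0_ler_powR; rewrite ?nnegrE ?(ltW q0) ?(ltW s0) ?(ltW a0)//.
    by move: avg; rewrite pow2D pow2_nat => /ltW.
  have b0 : (0 <= b)%R by rewrite -lee_fin -Iv.
  have := le_trans (ler_wpM2l b0 sa) ab.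
  rewrite powRM ?(ltW l0)//; last by rewrite mulr_ge0 ?(ltW t0)// exprn_ge0.
  rewrite powRM ?(ltW t0)// ?exprn_ge0// powRD ?(gt_eqF l0) ?implybT// powRr1 ?(ltW l0)//.
  rewrite powR_exprn//.
  rewrite powRN invrK.
  have := powR_gt0 q t0; have := powR_gt0 q l0.
  move: (t `^ q)%R (l `^ q)%R ((2 `^ q) ^+ m)%R hm => tq lq M hm lq0 tq1 H.
  have {}H : (b * (tq * M) <= A * l)%R.
    by rewrite -(ler_pM2r lq0); nra.
  have : (b * tq * (4 * A) <= A * l)%R.
    apply: le_trans H; rewrite -mulrA ler_wpM2l// ler_wpM2l// ltW//.
  nra.
have : (l%:E <= h G + (l / 2)%:E).
  rewrite /l -(dcontent_dcube hdelta Q).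
  apply: le_trans (leeD2l _ hB); apply: le_trans (dcontentU _ _ _).
  apply: dcontentS => x Qx; have [ut|ut] := leP (u x) t%:E.
    by right; split => //; exact: dual ut.
  by left.
rewrite -leeBlDr// -EFinB => H.
apply: (@le_trans _ _ (2%:E * (l - l / 2)%:E)).
  by rewrite -EFinM lee_fin; lra.
exact: lee_wpmul2l.
Qed.

(** Below [2 ^ N] each superlevel set is bounded by [E], and the levels [2 ^ (N - 1 - d)] sum to
    [2 ^ N]. *)
Lemma dchoquet_split E g (N : int) : I E g <= (pow2 N)%:E * h E +
  \esum_(d in [set: nat])
    ((pow2 (N + d%:Z))%:E * h [set x | E x /\ (pow2 (N + d%:Z))%:E < g x]).
Proof.
rewrite /dchoquet (@esum_int_split _ N); last by move=> i; exact: dterm_ge0.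
rewrite addeC; apply: leeD2r.
apply: (@le_trans _ _ (\esum_(d in [set: nat])
    (((pow2 (N - 1))%:E * (2^-1 ^+ d)%:E) * h E))).
  apply: le_esum => d _; rewrite -EFinM exprVn.
  have -> : (N - d.+1%:Z = N - 1 - d%:Z)%R by lia.
  rewrite [pow2 (_ - d%:Z)]pow2D pow2N pow2_nat.
  apply: lee_wpmul2l; first by rewrite lee_fin divr_ge0 ?pow2_ge0// exprn_ge0.
  by apply: dcontentS => x [].
have := dcontent_ge0 delta E; case: (h E) => [c|_|//]; last first.
  by rewrite gt0_muley ?leey// lte_fin pow2_gt0.
rewrite lee_fin => c0.
under eq_esum do rewrite -!EFinM mulrAC EFinM.
rewrite esumZ; last 2 first.
- by rewrite mulr_ge0// pow2_ge0.
- by move=> d; rewrite lee_fin exprn_ge0.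
rewrite esum_geom; last by rewrite invr_ge0 ler0n invf_lt1 ?ltr1n.
rewrite -!EFinM lee_fin pow2D pow2N pow2_1.
by rewrite le_eqVlt; apply/orP; left; apply/eqP; field.
Qed.

End Muckenhoupt.

(** * Dyadic Muckenhoupt pairs: comparison of weights and decay of both weights *)

Section MuckenhouptPair.
Local Open Scope classical_set_scope.
Local Open Scope ring_scope.
Local Open Scope ereal_scope.
Context {R : realType} {n : nat}.

(* A dyadic form of the [A_p] condition, where [sigma] plays the role of
   [w ^ (- 1 / (p - 1))]. *)
Record muckenhoupt_pair (delta p A : R) (w sigma : 'rV[R]_n -> \bar R) : Prop := {
  mp_p_gt1 : (1 < p)%R;
  mp_A_gt0 : (0 < A)%R;
  mp_dual_sigma : dual_weight (p - 1) sigma w;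
  mp_dual_w : dual_weight (p - 1)^-1 w sigma;
  mp_w_pos : forall Q : dyadic n, 0 < dchoquet delta (dcube Q) w;
  mp_sigma_pos : forall Q : dyadic n, 0 < dchoquet delta (dcube Q) sigma;
  mp_w_fin : forall Q : dyadic n, dchoquet delta (triple Q) w < +oo;
  mp_Ap : forall Q : dyadic n,
    dchoquet delta (triple Q) w * dchoquet delta (triple Q) sigma `^ (p - 1)
      <= (A * dcost delta Q `^ p)%:E }.

Variables (delta p A : R) (w sigma : 'rV[R]_n -> \bar R).
Implicit Types (P Q : dyadic n) (E F : set 'rV[R]_n) (f g : 'rV[R]_n -> \bar R).
Local Notation h := (dcontent delta).
Local Notation I := (dchoquet delta).
Local Notation dcost := (dcost delta).
Local Notation q := (p - 1)%R.
Hypothesis hdelta : (0 < delta <= n%:R)%R.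
Hypothesis hw : muckenhoupt_pair delta p A w sigma.
Let p_gt1 := mp_p_gt1 hw.
Let A_gt0 := mp_A_gt0 hw.
Let dual_sigma := mp_dual_sigma hw.
Let dual_w := mp_dual_w hw.
Let w_pos := mp_w_pos hw.
Let sigma_pos := mp_sigma_pos hw.
Let w_fin := mp_w_fin hw.
Let Ap_triple := mp_Ap hw.
Hint Resolve dcontent_ge0 dchoquet_ge0 : core.

Let q_gt0 : (0 < q)%R. Proof. by rewrite subr_gt0. Qed.

(** The integral of [sigma] is finite because that of [w] is positive and the product in the [A_p]
    bound is finite. *)
Lemma Ap_real Q E : dcube Q `<=` E -> E `<=` triple Q ->
  exists W S : R, [/\ (0 < W)%R, (0 < S)%R, I E w = W%:E, I E sigma = S%:E &
    (W * S `^ q <= A * dcost Q `^ p)%R].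
Proof.
move=> QE EQ.
have W0 : 0 < I E w by apply: lt_le_trans (dchoquetS _ _ QE).
have S0 : 0 < I E sigma by apply: lt_le_trans (dchoquetS _ _ QE).
have Wy : I E w < +oo by apply: le_lt_trans (dchoquetS _ _ EQ) (w_fin Q).
have AE : I E w * I E sigma `^ q <= (A * dcost Q `^ p)%:E.
  apply: le_trans (Ap_triple Q); apply: lee_pmul; [exact: dchoquet_ge0|exact: poweR_ge0|exact: dchoquetS|].
  apply: gt0_ler_poweR; [exact: ltW|by rewrite in_itv/= dchoquet_ge0 leey..|].
  exact: dchoquetS.
move: W0 S0 Wy AE; case: (I E w) => [W| |]//; case: (I E sigma) => [S| |]//.
  rewrite !lte_fin => W0 S0 _; rewrite poweR_EFin -EFinM lee_fin.
  by exists W, S.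
by move=> W0 _ _; rewrite poweRyr ?gt_eqF// gt0_muley.
Qed.

(** At the level [t = 4 S / (kappa * dcost P)], Markov's inequality for [sigma] removes at most half
    of the content guaranteed for [E]. On the rest [w >= t ^ (- q)], and the [A_p] bound compares
    this value with the weight of the triple. *)
Lemma Ap_infty (kappa : R) : (0 < kappa)%R -> exists2 C : R, (0 < C)%R &
  forall P E, E `<=` triple P -> (kappa * dcost P)%:E <= h E ->
    I (triple P) w <= C%:E * I E w.
Proof.
move=> k0; have k4 : (0 < 4 / kappa)%R by rewrite divr_gt0.
exists (A * (4 / kappa) `^ q * (4 / kappa))%R.
  by rewrite mulr_gt0// mulr_gt0// powR_gt0.
move=> P E EP hE.
have [W [S [W0 S0 -> IS WS]]] := Ap_real (dcube_triple (i := P)) (@subset_refl _ _).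
set l := dcost P in hE WS; have l0 : (0 < l)%R by exact: dcost_gt0.
have kl0 : (0 < kappa * l)%R by rewrite mulr_gt0.
pose t := (4 * S / (kappa * l))%R; have t0 : (0 < t)%R by rewrite divr_gt0// mulr_gt0.
have tq0 : (0 < t `^ (- q))%R by rewrite powR_gt0.
have h1 : h [set x | E x /\ t%:E <= sigma x] <= (kappa * l / 2)%:E.
  apply: (@le_trans _ _ (h [set x | triple P x /\ t%:E <= sigma x])).
    by apply: dcontentS => x [Ex tx]; split => //; exact: EP.
  have := dchoquet_markov delta (triple P) sigma t0.
  rewrite -lee_pdivlMl// => /le_trans; apply.
  rewrite IS -!EFinM lee_fin /t le_eqVlt; apply/orP; left; apply/eqP.
  by field; rewrite ?gt_eqF.
have h2 : (kappa * l / 2)%:E <= h [set x | E x /\ (t `^ (- q))%:E <= w x].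
  have : (kappa * l)%:E <= h [set x | E x /\ (t `^ (- q))%:E <= w x] +
      (kappa * l / 2)%:E.
    apply: le_trans hE _; apply: le_trans (leeD2l _ h1).
    apply: le_trans (dcontentU _ _ _); apply: dcontentS => x Ex.
    have [tx|tx] := leP t%:E (sigma x); first by right.
    by left; split => //; apply: dual_sigma => //; exact: ltW.
  rewrite -leeBlDr// -EFinB => /(le_trans _); apply.
  by rewrite lee_fin; lra.
have h3 : (t `^ (- q) * (kappa * l / 2))%:E <= 2%:E * I E w.
  apply: le_trans (dchoquet_markov _ _ _ tq0); rewrite EFinM.
  by apply: lee_wpmul2l => //; rewrite lee_fin ltW.
have Wle : (W <= A * (4 / kappa) `^ q * (4 / kappa) *
    (t `^ (- q) * (kappa * l / 2) / 2))%R.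
  have Sq0 : (0 < S `^ q)%R by rewrite powR_gt0.
  rewrite -(ler_pM2r Sq0); apply: le_trans WS _.
  have -> : (l `^ p = l * l `^ q)%R.
    by rewrite mulr_powRB1 ?(ltW l0)// (lt_trans ltr01).
  have -> : (t `^ (- q) = (S `^ q)^-1 * ((4 / kappa) `^ q)^-1 * l `^ q)%R.
    rewrite powRN (_ : t = S * (4 / kappa) * l^-1)%R; last first.
      by rewrite /t; field; rewrite ?gt_eqF.
    rewrite powRM ?invr_ge0 ?(ltW l0)//; last by rewrite mulr_ge0 ?divr_ge0 ?ltW.
    rewrite powRM ?(ltW S0)//; last by rewrite divr_ge0// ltW.
    by rewrite -(powR_inv1 (ltW l0)) -powRrM mulN1r powRN !invfM invrK.
  have c0 : (0 < (4 / kappa) `^ q)%R by rewrite powR_gt0 ?divr_gt0.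
  rewrite le_eqVlt; apply/orP; left; apply/eqP.
  by field; rewrite ?gt_eqF.
apply: (@le_trans _ _ ((A * (4 / kappa) `^ q * (4 / kappa))%:E *
    (2^-1%:E * (t `^ (- q) * (kappa * l / 2))%:E))).
  by rewrite -!EFinM lee_fin [(2^-1 * _)%R]mulrC.
apply: lee_wpmul2l.
  by rewrite lee_fin !mulr_ge0 ?powR_ge0 ?invr_ge0 ?(ltW A_gt0) ?(ltW k0).
by rewrite lee_pdivrMl.
Qed.

Lemma sigma_decay : exists2 theta : R, (0 < theta < 1)%R &
  forall Q k (r : nat), I (dcube Q) sigma <= (pow2 k * dcost Q)%:E ->
    h [set x | dcube Q x /\ (pow2 (k + r%:Z))%:E < sigma x]
      <= (theta ^+ r * 2^-1 ^+ r * dcost Q)%:E.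
Proof.
have [m med] : exists m, median_bound delta m sigma.
  apply: (median_bound_Ap hdelta q_gt0 A_gt0 dual_sigma) => Q.
  have [W [S [W0 S0 IW IS WS]]] :=
    Ap_real (@subset_refl _ (dcube Q)) (dcube_triple (i := Q)).
  by exists S, W; split => //; rewrite (_ : (1 + q = p)%R)//; ring.
have [theta th H] := median_bound_decay hdelta m.
by exists theta => // Q k r; exact: H.
Qed.

(** The [A_p] inequality raised to the power [1 / (p - 1)] is the dual condition, with [w] and
    [sigma] exchanged. *)
Lemma w_decay : exists2 theta : R, (0 < theta < 1)%R &
  forall Q k (r : nat), I (dcube Q) w <= (pow2 k * dcost Q)%:E ->
    h [set x | dcube Q x /\ (pow2 (k + r%:Z))%:E < w x]
      <= (theta ^+ r * 2^-1 ^+ r * dcost Q)%:E.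
Proof.
have q'0 : (0 < q^-1)%R by rewrite invr_gt0.
have [m med] : exists m, median_bound delta m w.
  apply: (median_bound_Ap hdelta q'0 _ dual_w (A := (A `^ q^-1)%R)).
    by rewrite powR_gt0.
  move=> Q; have [W [S [W0 S0 IW IS WS]]] :=
    Ap_real (@subset_refl _ (dcube Q)) (dcube_triple (i := Q)).
  exists W, S; split => //.
  have : ((W * S `^ q) `^ q^-1 <= (A * dcost Q `^ p) `^ q^-1)%R.
    apply: ge0_ler_powR => //; rewrite ?nnegrE ?invr_ge0 ?mulr_ge0 ?powR_ge0 //; exact: ltW.
  rewrite (powRM _ (ltW W0) (powR_ge0 _ _)) (powRM _ (ltW A_gt0) (powR_ge0 _ _)).
  rewrite -!powRrM divff; last by rewrite gt_eqF.
  rewrite (powRr1 (ltW S0)) mulrC.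
  have -> : (p / q = 1 + q^-1)%R by field; rewrite gt_eqF.
  by [].
have [theta th H] := median_bound_decay hdelta m.
by exists theta => // Q k r; exact: H.
Qed.

End MuckenhouptPair.

(** * Estimates on a single dyadic cube *)

Section LocalEstimates.
Local Open Scope classical_set_scope.
Local Open Scope ring_scope.
Local Open Scope ereal_scope.
Context {R : realType} {n : nat}.
Variables (delta p A : R) (w sigma : 'rV[R]_n -> \bar R).
Implicit Types (P Q : dyadic n) (E F : set 'rV[R]_n) (f g : 'rV[R]_n -> \bar R).
Local Notation h := (dcontent delta).
Local Notation I := (dchoquet delta).
Local Notation dcost := (dcost delta).
Local Notation q := (p - 1)%R.
Hypothesis hdelta : (0 < delta <= n%:R)%R.
Hypothesis hw : muckenhoupt_pair delta p A w sigma.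
Let p_gt1 := mp_p_gt1 hw.
Let A_gt0 := mp_A_gt0 hw.
Let q_gt0 : (0 < q)%R. Proof. by rewrite subr_gt0. Qed.

Lemma exists_dyadic_average Q (W : R) : (0 < W)%R ->
  exists k, (pow2 (k - 1) * dcost Q < W <= pow2 k * dcost Q)%R.
Proof.
move=> W0; have l0 : (0 < dcost Q)%R by exact: dcost_gt0.
have [k] := pow2_bracket (divr_gt0 W0 l0).
by rewrite ltr_pdivlMr// ler_pdivrMr//; exists k.
Qed.

(** Ensures that maximal cubes exist. Let [2 ^ k] be about the average of [w] on [Q]. By [w_decay]
    on [Q], the levels from [2 ^ (k + r)] on contribute at most half of the weight [W0] of [Q0] once
    [r] is large, so the lower ones give [W0 / 2 <= 2 ^ (k + r) * dcost Q0]. Since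
    [2 ^ k * dcost Q <= 2 B], this bounds [dcost Q] by [M]. *)
Lemma gen_bounded (B : R) Q0 : exists K : int,
  forall Q, dsub Q0 Q -> I (dcube Q) w <= B%:E -> (Q.1 <= K)%R.
Proof.
have [theta /andP[th0 th1] decay] := w_decay hdelta hw.
have [W0 [_ [W00 _ IW0 _ _]]] :=
  Ap_real hw (@subset_refl _ (dcube Q0)) (dcube_triple (i := Q0)).
have [B0|B0] := leP B 0%R.
  exists 0%R => Q _ WB; exfalso.
  have := lt_le_trans (mp_w_pos hw Q) WB; rewrite lte_fin => /(le_lt_trans B0).
  by rewrite ltxx.
have ith0 : (0 < 1 - theta)%R by rewrite subr_gt0.
have [r hr] : exists r : nat, (2 * B * (theta ^+ r / (1 - theta)) <= W0 / 2)%R.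
  have th : (0 < theta < 1)%R by rewrite th0.
  have W2 : (0 < W0 / 2)%R by rewrite divr_gt0.
  have [r hr] := expr_small (2 * B / (1 - theta)) th W2.
  by exists r; rewrite mulrA mulrAC.
pose M := (4 * B * 2 ^+ r * dcost Q0 / W0)%R.
have M0 : (0 < M)%R by rewrite divr_gt0// mulr_gt0 ?dcost_gt0// mulr_gt0 ?exprn_gt0// mulr_gt0.
have /andP[d0 _] := hdelta.
have [K /andP[_ hK]] := pow2_bracket (powR_gt0 delta^-1 M0).
exists K => Q Q0Q WB.
have [W [_ [Wp _ IW _ _]]] :=
  Ap_real hw (@subset_refl _ (dcube Q)) (dcube_triple (i := Q)).
have {}WB : (W <= B)%R by move: WB; rewrite IW lee_fin.
have [k /andP[k1 k2]] := exists_dyadic_average Q Wp.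
have pk : (pow2 k * dcost Q <= 2 * B)%R.
  apply: le_trans (ler_wpM2l _ WB) => //.
  by move: k1; rewrite pow2D pow2N pow2_1 => /ltW; lra.
suff lM : (dcost Q <= M)%R.
  rewrite -(ler_pow2 (R := R)); apply: le_trans hK.
  have -> : pow2 Q.1 = (dcost Q `^ delta^-1)%R :> R.
    by rewrite -powRrM divff ?gt_eqF// powRr1 ?pow2_ge0.
  by apply: ge0_ler_powR; rewrite ?nnegrE ?invr_ge0 ?dcost_ge0 ?(ltW d0) ?(ltW M0).
have := dchoquet_split hdelta (dcube Q0) w (k + r%:Z)%R.
rewrite IW0.
have H : \esum_(d in [set: nat]) ((pow2 (k + r%:Z + d%:Z))%:E *
    h [set x | dcube Q0 x /\ (pow2 (k + r%:Z + d%:Z))%:E < w x])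
   <= (2 * B * (theta ^+ r / (1 - theta)))%:E.
  apply: (@le_trans _ _ (\esum_(d in [set: nat]) ((2 * B * theta ^+ r)%:E * (theta ^+ d)%:E))).
    apply: le_esum => d _.
    apply: (@le_trans _ _ ((pow2 (k + r%:Z + d%:Z))%:E *
       (theta ^+ (r + d) * 2^-1 ^+ (r + d) * dcost Q)%:E)).
      apply: lee_wpmul2l; first exact: pow2E_ge0.
      have e : (k + r%:Z + d%:Z = k + (r + d)%N%:Z)%R by rewrite -addrA -PoszD.
      apply: le_trans (decay Q k (r + d)%N _); last by rewrite IW lee_fin.
      by rewrite e; apply: dcontentS => x [/(dsub_cube Q0Q) Qx wx].
    rewrite -!EFinM lee_fin.
    have -> : (pow2 (k + r%:Z + d%:Z) * (theta ^+ (r + d) * 2^-1 ^+ (r + d) * dcost Q)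
       = theta ^+ r * theta ^+ d * (pow2 k * dcost Q))%R.
      rewrite -addrA -PoszD pow2D pow2_nat [(theta ^+ (r + d))%R]exprD exprVn.
      have : (2 ^+ (r + d) != 0 :> R)%R by rewrite expf_neq0.
      move: (2 ^+ (r + d))%R (theta ^+ r)%R (theta ^+ d)%R => x y z x0.
      by field.
    have := ler_wpM2l (mulr_ge0 (exprn_ge0 r (ltW th0)) (exprn_ge0 d (ltW th0))) pk.
    by move: (theta ^+ r)%R (theta ^+ d)%R => x y; lra.
  rewrite esumZ; last 2 first.
  - by rewrite !mulr_ge0 ?exprn_ge0 ?ltW.
  - by move=> d; rewrite lee_fin exprn_ge0// ltW.
  by rewrite esum_geom ?(ltW th0)// -EFinM mulrA.
move=> /le_trans /(_ (leeD2l _ H)).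
rewrite dcontent_dcube// -EFinM -EFinD lee_fin pow2D pow2_nat => H2.
have {}H2 : (W0 / 2 <= pow2 k * 2 ^+ r * dcost Q0)%R by lra.
have l0 := dcost_gt0 delta Q; have l00 := dcost_gt0 delta Q0.
rewrite /M ler_pdivlMr//.
have := ler_wpM2r (ltW l0) H2.
have x0 : (0 <= 2 ^+ r * dcost Q0)%R by rewrite mulr_ge0 ?exprn_ge0 ?(ltW l00).
have := ler_wpM2r x0 pk.
move: (pow2 k) (2 ^+ r)%R (dcost Q) (dcost Q0) => a b c d; lra.
Qed.

(** Split [E] at [t = 2 ^ (k + r)], where [2 ^ k] is about the average of [sigma] on [Q]. Where
    [sigma > t], the improved decay bounds the content. Elsewhere [w >= t ^ (- q)], so the content
    is controlled by the weight of [E], and the [A_p] bound converts [t ^ q] times the weight of [Q]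
    into [(2 ^ q) ^ r * dcost Q], up to a constant. *)
Lemma local_estimate : exists theta C : R, [/\ (0 < theta < 1)%R, (0 < C)%R &
  forall Q E (r : nat), E `<=` dcube Q ->
    I (dcube Q) w * h E <= (dcost Q)%:E *
      ((theta ^+ r * 2^-1 ^+ r)%:E * I (dcube Q) w
       + (C * (2 `^ q) ^+ r)%:E * I E w)].
Proof.
have [theta th decay] := sigma_decay hdelta hw.
exists theta, (2 * A * 2 `^ q)%R; split => //.
  by rewrite mulr_gt0 ?powR_gt0// mulr_gt0.
move=> Q E r EQ.
have [W [S [W0 S0 IW IS WS]]] :=
  Ap_real hw (@subset_refl _ (dcube Q)) (dcube_triple (i := Q)).
have l0 := dcost_gt0 delta Q.
have [k /andP[k1 k2]] := exists_dyadic_average Q S0.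
set t : R := pow2 (k + r%:Z); have t0 : (0 < t)%R by exact: pow2_gt0.
have tq0 : (0 < t `^ (- q))%R by rewrite powR_gt0.
have h1 : h [set x | E x /\ t%:E < sigma x]
    <= (theta ^+ r * 2^-1 ^+ r * dcost Q)%:E.
  apply: le_trans (decay Q k r _); last by rewrite IS lee_fin.
  by apply: dcontentS => x [/EQ].
have h2 : h [set x | E x /\ (t `^ (- q))%:E <= w x] <= (2 * t `^ q)%:E * I E w.
  have := dchoquet_markov delta E w tq0.
  rewrite -lee_pdivlMl// => /le_trans; apply.
  by rewrite powRN invrK muleA -EFinM mulrC.
have h3 : h E <= (theta ^+ r * 2^-1 ^+ r * dcost Q)%:E + (2 * t `^ q)%:E * I E w.
  apply: le_trans (leeD h1 h2); apply: le_trans (dcontentU _ _ _).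
  apply: dcontentS => x Ex; have [tx|tx] := leP (sigma x) t%:E.
    by right; split => //; exact: (mp_dual_sigma hw).
  by left.
have Wt : (W * (2 * t `^ q) <= dcost Q * (2 * A * 2 `^ q * (2 `^ q) ^+ r))%R.
  have tS : (t `^ q <= (S * 2 ^+ r.+1 / dcost Q) `^ q)%R.
    have tS' : (t <= S * 2 ^+ r.+1 / dcost Q)%R.
      rewrite ler_pdivlMr// /t pow2D pow2_nat exprS.
      have x0 : (0 <= 2 ^+ r :> R)%R by rewrite exprn_ge0.
      have := ler_wpM2r x0 (ltW k1); rewrite pow2D pow2N pow2_1.
      by move: (pow2 k) (2 ^+ r)%R => a b; lra.
    apply: ge0_ler_powR; rewrite ?nnegrE ?(ltW q_gt0) ?(ltW t0)//.
    exact: le_trans (ltW t0) tS'.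
  move: tS; rewrite powRM ?invr_ge0 ?(ltW l0)//; last first.
    by rewrite mulr_ge0 ?exprn_ge0 ?(ltW S0).
  rewrite powRM ?exprn_ge0 ?(ltW S0)//.
  have -> : ((2 ^+ r.+1) `^ q = 2 `^ q * (2 `^ q) ^+ r :> R)%R.
    by rewrite powR_exprn// exprS.
  have -> : (((dcost Q)^-1) `^ q = (dcost Q `^ q)^-1)%R.
    by rewrite -(powR_inv1 (ltW l0)) -powRrM mulN1r powRN.
  have lp : (dcost Q `^ p = dcost Q * dcost Q `^ q)%R.
    by rewrite mulr_powRB1 ?(ltW l0)// (lt_trans ltr01).
  have lq0 : (0 < dcost Q `^ q)%R by rewrite powR_gt0.
  have : (0 < 2 `^ q :> R)%R by rewrite powR_gt0.
  have : (0 <= (2 `^ q) ^+ r :> R)%R by rewrite exprn_ge0// powR_ge0.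
  move: WS; rewrite lp; move: (t `^ q)%R (S `^ q)%R (dcost Q `^ q)%R lq0.
  move: ((2 `^ q) ^+ r)%R (2 `^ q)%R => X Y tq Sq lq lq0 WS X0 Y0 tS.
  have a1 := ler_wpM2l (ltW W0) tS.
  have a2 : (W * Sq / lq <= A * dcost Q)%R by rewrite ler_pdivrMr// -mulrA.
  have a3 := ler_wpM2r (mulr_ge0 (ltW Y0) X0) a2.
  by lra.
have Jfin : I E w \is a fin_num.
  rewrite ge0_fin_numE ?dchoquet_ge0//.
  by apply: le_lt_trans (dchoquetS _ _ EQ) _; rewrite IW ltry.
rewrite IW; apply: le_trans (lee_wpmul2l _ h3) _; first by rewrite lee_fin ltW.
have J0 : (0 <= fine (I E w))%R by rewrite fine_ge0 ?dchoquet_ge0.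
rewrite -(fineK Jfin) -!(EFinM, EFinD) lee_fin.
move: (fine (I E w)) J0 => J J0; have := ler_wpM2r J0 Wt.
move: (theta ^+ r)%R (2^-1 ^+ r)%R (t `^ q)%R ((2 `^ q) ^+ r)%R => x y z u.
lra.
Qed.

(* With [r = b + d - d %/ N], the factor [theta ^+ r] lets the first sum
   converge although [r < d], while [r < d] lets the second one converge. *)
Lemma local_distribution : exists (c : nat -> R) (M : R), [/\
  forall d, (0 <= c d)%R,
  \esum_(d in [set: nat]) (c d * (2 `^ (- p)) ^+ d)%:E <= M%:E &
  forall f Q k, (pow2 k * dcost Q)%:E < I (dcube Q) f ->
    I (dcube Q) w <= \esum_(d in [set: nat])
      ((c d)%:E * I [set x | dcube Q x /\ (pow2 (k - 1 + d%:Z))%:E < f x] w)].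
Proof.
have [theta [C [/andP[th0 th1] C0 locest]]] := local_estimate.
(* Half of the decay, [t ^ d] out of [theta ^ d = t ^ (2 d)], absorbs the loss
   [(2 / theta) ^ (d %/ N)] caused by [r d < b + d]; the choice [2 * t ^ N <= theta] makes this
   possible. The other half is summed. *)
pose t := Num.sqrt theta.
have t0 : (0 < t)%R by rewrite sqrtr_gt0.
have tt : (t ^+ 2 = theta)%R by rewrite sqr_sqrtr// ltW.
have t1 : (t < 1)%R by rewrite -(ltr_pXn2r (n := 2)) ?nnegrE ?ltW// tt expr1n.
have tt01 : (0 < t < 1)%R by rewrite t0.
have [N hN] := expr_small 2 tt01 th0.
have half01 : (0 < (2^-1 : R) < 1)%R by rewrite invr_gt0 invf_lt1 ?ltr1n ?ltr0n.
have half0 : (0 < 2^-1 :> R)%R by [].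
(* [b] makes the first sum at most 1/2, so that it can be absorbed in the left-hand side. *)
have [b hb] := expr_small ((1 - t)^-1)%R half01 half0.
have N0 : (0 < N)%N.
  case: N hN => // /=; rewrite expr0 mulr1 => h21; lra.
pose r d := (b + d - d %/ N)%N.
have rE d : (r d + d %/ N = b + d)%N.
  by rewrite /r subnK// (leq_trans (leq_div _ _))// leq_addl.
pose c d : R := (2 * C * 2 ^+ d * (2 `^ q) ^+ (r d))%R.
have c0 d : (0 <= c d)%R by rewrite !mulr_ge0 ?exprn_ge0 ?powR_ge0 ?(ltW C0).
have first_sum d : (2 ^+ d * (theta ^+ r d * 2^-1 ^+ r d) <= 2^-1 ^+ b * t ^+ d)%R.
  have m0 : (0 < theta ^+ (d %/ N) * 2^-1 ^+ (d %/ N))%R.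
    by rewrite mulr_gt0 ?exprn_gt0.
  rewrite -(ler_pM2r m0).
  have -> : (2 ^+ d * (theta ^+ r d * 2^-1 ^+ r d) *
      (theta ^+ (d %/ N) * 2^-1 ^+ (d %/ N)) =
      2 ^+ d * (theta ^+ (b + d) * 2^-1 ^+ (b + d)))%R by rewrite -rE !exprD; ring.
  have -> : (2 ^+ d * (theta ^+ (b + d) * 2^-1 ^+ (b + d)) =
      2^-1 ^+ b * (theta ^+ (b + d)))%R.
    by rewrite [(2^-1 ^+ (b + d))%R]exprD exprVn [(2^-1 ^+ d)%R]exprVn; field; rewrite !expf_neq0.
  rewrite -mulrA ler_wpM2l ?exprn_ge0//.
  apply: (@le_trans _ _ (theta ^+ d)%R).
    by rewrite exprD ler_piMl ?exprn_ge0 ?exprn_ile1// ltW.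
  rewrite -{1}tt -exprM mulnC exprM expr2 ler_wpM2l ?exprn_ge0 ?(ltW t0)//.
  apply: (@le_trans _ _ ((t ^+ N) ^+ (d %/ N))%R).
    rewrite -exprM ler_wiXn2l ?(ltW t0) ?(ltW t1)// mulnC; exact: leq_trunc_div.
  rewrite -exprMn lerXn2r ?nnegrE ?exprn_ge0 ?mulr_ge0 ?(ltW t0) ?(ltW th0)//.
  lra.
(* Since [2 * 2 ^ q * 2 ^ (- p) = 1], only [2 ^ (- q * (d %/ N))] is left of the decay; rounding
   down the quotient costs one more factor [2 ^ q], hence the exponent [b.+1]. *)
pose y : R := (2 `^ (- q / N%:R))%R.
have second_sum d : (c d * (2 `^ (- p)) ^+ d
    <= 2 * C * (2 `^ q) ^+ b.+1 * y ^+ d)%R.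
  rewrite /c exprS -!mulrA ler_wpM2l// ler_wpM2l ?(ltW C0)//.
  have q2 : (0 < (2 `^ q) ^+ (d %/ N) :> R)%R by rewrite exprn_gt0 ?powR_gt0.
  rewrite -(ler_pM2r q2).
  have -> : (2 ^+ d * ((2 `^ q) ^+ r d * (2 `^ (- p)) ^+ d) * (2 `^ q) ^+ (d %/ N) =
      (2 `^ q) ^+ b * (2 * 2 `^ q * 2 `^ (- p)) ^+ d :> R)%R.
    have H : ((2 `^ q) ^+ r d * (2 `^ q) ^+ (d %/ N) = (2 `^ q) ^+ b * (2 `^ q) ^+ d :> R)%R.
      by rewrite -!exprD rE.
    rewrite !exprMn; move: H; move: ((2 `^ q) ^+ r d)%R ((2 `^ q) ^+ (d %/ N))%R.
    move: ((2 `^ q) ^+ d)%R ((2 `^ q) ^+ b)%R ((2 `^ (- p)) ^+ d)%R (2 ^+ d)%R.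
    move=> x1 x2 x3 x4 x5 x6 H.
    have -> : (x4 * (x5 * x3) * x6 = x4 * x3 * (x5 * x6))%R by ring.
    by rewrite H; ring.
  have -> : (2 * 2 `^ q * 2 `^ (- p) = 1 :> R)%R.
    rewrite -{1}[(2 : R)%R]powRr1// -!powR2D.
      by rewrite (_ : 1 + q + - p = 0)%R ?powRr0//; ring.
  rewrite expr1n mulr1.
  suff H : (1 <= 2 `^ q * (y ^+ d * (2 `^ q) ^+ (d %/ N)))%R.
    have := ler_wpM2l (exprn_ge0 b (powR_ge0 2 q)) H; rewrite mulr1 => /le_trans; apply.
    by rewrite le_eqVlt; apply/orP; left; apply/eqP; ring.
  rewrite -!powR_mulrn ?powR_ge0// -!powRrM -!powR2D.
  have := ler_powR2 (0 : R); rewrite powRr0 => ->.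
  have NR : (0 < N%:R :> R)%R by rewrite ltr0n.
  have -> : (q + ((- q / N%:R) * d%:R + q * (d %/ N)%:R) =
     q / N%:R * ((d %/ N).+1%:R * N%:R - d%:R) :> R)%R.
    by rewrite -natr1; field; rewrite gt_eqF.
  rewrite mulr_ge0 ?divr_ge0 ?(ltW q_gt0) ?(ltW NR)// subr_ge0 -natrM ler_nat.
  exact/ltnW/ltn_ceil.
have y01 : (0 <= y < 1)%R.
  rewrite powR_ge0/=; have := ltr_powR2 (- q / N%:R) (0 : R); rewrite powRr0 => ->.
  by rewrite mulNr oppr_lt0 divr_gt0// ltr0n.
exists c, (2 * C * (2 `^ q) ^+ b.+1 / (1 - y))%R; split => //.
  apply: (@le_trans _ _ (\esum_(d in [set: nat])
     ((2 * C * (2 `^ q) ^+ b.+1)%:E * (y ^+ d)%:E))).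
    by apply: le_esum => d _; rewrite -EFinM lee_fin.
  rewrite esumZ; last 2 first.
  - by rewrite !mulr_ge0 ?exprn_ge0 ?powR_ge0 ?(ltW C0).
  - by move=> d; rewrite lee_fin exprn_ge0//; case/andP: y01.
  by rewrite esum_geom// -EFinM.
move=> f Q k avg.
have [W [_ [W0 _ IW _ _]]] :=
  Ap_real hw (@subset_refl _ (dcube Q)) (dcube_triple (i := Q)).
have l0 := dcost_gt0 delta Q.
have p0 : (0 < pow2 (k - 1) :> R)%R by exact: pow2_gt0.
pose E d := [set x | dcube Q x /\ (pow2 (k - 1 + d%:Z))%:E < f x].
have EQ d : E d `<=` dcube Q by move=> x [].
set s := \esum_(d in _) _.
have s0 : 0 <= s.
  by apply: esum_ge0 => d _; rewrite mule_ge0 ?lee_fin ?dchoquet_ge0.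
have key : (pow2 (k - 1) * dcost Q * W)%:E <=
    (pow2 (k - 1) * dcost Q)%:E * ((2^-1 * W)%:E + 2^-1%:E * s).
  have split_f := dchoquet_split hdelta (dcube Q) f (k - 1)%R.
  (* The levels below [2 ^ (k - 1)] account for at most [2 ^ (k - 1) * dcost Q], half of the assumed
     lower bound; the remaining levels carry the other half. *)
  have {split_f} : (pow2 (k - 1) * dcost Q)%:E <= \esum_(d in [set: nat])
      ((pow2 (k - 1 + d%:Z))%:E * h (E d)).
    have := lt_le_trans avg split_f.
    rewrite dcontent_dcube// -EFinM -lteBlDl// -EFinB => /ltW.
    apply: le_trans; rewrite lee_fin.
    rewrite [X in (_ <= X * _ - _)%R](_ : _ = 2 * pow2 (k - 1))%R; first by lra.
    by rewrite pow2D pow2N pow2_1; field.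
  move=> /(lee_wpmul2l (_ : 0 <= W%:E)) => /(_ (ltW W0)).
  rewrite -EFinM mulrC => /le_trans; apply.
  rewrite -esumZ ?(ltW W0)//; last by move=> d; exact: dterm_ge0.
  apply: (@le_trans _ _ (\esum_(d in [set: nat]) ((pow2 (k - 1) * dcost Q)%:E *
     ((2^-1 ^+ b * W)%:E * (t ^+ d)%:E + 2^-1%:E * ((c d)%:E * I (E d) w))))).
    apply: le_esum => d _.
    rewrite muleCA; have := locest Q (E d) (r d) (EQ d).
    move=> /(lee_wpmul2l (pow2E_ge0 (R := R) (k - 1 + d%:Z))); rewrite IW.
    move=> /le_trans; apply.
    have Jfin : I (E d) w \is a fin_num.
      rewrite ge0_fin_numE ?dchoquet_ge0//.
      by apply: le_lt_trans (dchoquetS _ _ (EQ d)) _; rewrite IW ltry.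
    rewrite -(fineK Jfin) -!(EFinM, EFinD) lee_fin /c [pow2 (_ + d%:Z)]pow2D pow2_nat.
    have plW : (0 <= pow2 (k - 1) * dcost Q * W)%R.
      by rewrite mulr_ge0 ?(ltW W0)// mulr_ge0 ?(ltW p0) ?(ltW l0).
    have := ler_wpM2l plW (first_sum d).
    move: (theta ^+ r d)%R (2^-1 ^+ r d)%R (2 ^+ d)%R (2^-1 ^+ b)%R (t ^+ d)%R.
    move: (pow2 (k - 1)) ((2 `^ q) ^+ r d)%R (fine _) => x1 x2 x3 x4 x5 x6 x7 x8.
    lra.
  rewrite esumZ; last 2 first.
  - by rewrite mulr_ge0 ?(ltW p0) ?(ltW l0).
  - move=> d; rewrite adde_ge0 ?mule_ge0 ?lee_fin ?dchoquet_ge0//.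
    by rewrite mulr_ge0 ?exprn_ge0 ?(ltW W0).
    by rewrite exprn_ge0 ?(ltW t0).
  apply: lee_wpmul2l; first by rewrite lee_fin mulr_ge0 ?(ltW p0) ?(ltW l0).
  rewrite esumD; last 2 first.
  - by move=> d _; rewrite mule_ge0// lee_fin ?mulr_ge0 ?exprn_ge0 ?(ltW W0) ?(ltW t0).
  - by move=> d _; rewrite mule_ge0// mule_ge0 ?lee_fin ?dchoquet_ge0.
  apply: leeD.
    rewrite esumZ; last 2 first.
    - by rewrite mulr_ge0 ?exprn_ge0 ?(ltW W0).
    - by move=> d; rewrite lee_fin exprn_ge0 ?(ltW t0).
    rewrite esum_geom ?(ltW t0)// -EFinM lee_fin mulrAC ler_wpM2r ?(ltW W0)//.
    by rewrite mulrC.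
  rewrite esumZ// => d; rewrite mule_ge0 ?lee_fin ?dchoquet_ge0//.
have {key} : W%:E <= (2^-1 * W)%:E + 2^-1%:E * s.
  move: key; rewrite EFinM lee_pmul2l// lte_fin mulr_gt0//.
(* Half of the finite weight [W] is absorbed on the left. *)
rewrite IW; move: s0; case: (s) => [s'| |]//; last by move=> *; rewrite leey.
by move=> _; rewrite -EFinM -EFinD !lee_fin; lra.
Qed.

End LocalEstimates.

(** * Packed families and near additivity of the content *)

Section Packing.
Local Open Scope classical_set_scope.
Local Open Scope ring_scope.
Local Open Scope ereal_scope.
Context {R : realType} {n : nat}.
Variable delta : R.
Hypothesis hdelta : (0 < delta <= n%:R)%R.
Implicit Types (P Q : dyadic n) (E : set 'rV[R]_n) (g : 'rV[R]_n -> \bar R).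
Implicit Types (F S : set (dyadic n)).
Local Notation h := (dcontent delta).
Local Notation I := (dchoquet delta).
Local Notation dcost := (dcost delta).

Let dcostE0 Q : 0 <= (dcost Q)%:E. Proof. by rewrite lee_fin dcost_ge0. Qed.

(* The content is not additive on disjoint cubes; on a packed antichain it is
   superadditive up to a factor 3. *)
Definition packing S := forall P,
  \esum_(Q in [set Q | S Q /\ dsub Q P]) (dcost Q)%:E <= 2%:E * (dcost P)%:E.

(** A finite partial sum involves finitely many cubes, all in one member of a chain; this carries
    the packing condition over to unions of chains, as Zorn's lemma requires. *)
Lemma seq_in_chain (T : choiceType) (C : set (set T)) (X : seq T) :
  total_on C subset -> C !=set0 ->
  (forall x, x \in X -> exists2 A, C A & A x) ->
  exists2 A, C A & forall x, x \in X -> A x.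
Proof.
move=> tot [A0 CA0]; elim: X => [|x X IH] H; first by exists A0.
have [|A CA AX] := IH; first by move=> y yX; apply: H; rewrite inE yX orbT.
have [B CB Bx] := H x (mem_head _ _).
have [AB|BA] := tot _ _ CA CB.
  by exists B => // y; rewrite inE => /predU1P[->//|/AX]; exact: AB.
by exists A => // y; rewrite inE => /predU1P[->|/AX//]; exact: BA.
Qed.

(** If a rejected [Q] violates the packing condition at some [P] above it, then [S] alone already
    has cost at least [dcost P] inside [P], because [dcost Q <= dcost P] and the threshold is
    [2 * dcost P]. *)
Lemma exists_packing F : exists S, [/\ S `<=` F, packing S &
  forall Q, F Q -> S Q \/ exists2 P, dsub Q P &
    (dcost P)%:E <= \esum_(Q' in [set Q' | S Q' /\ dsub Q' P]) (dcost Q')%:E].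
Proof.
have [C HC totC|S [[SF Spack] Smax]] :=
  @Zorn_bigcup _ (fun S => S `<=` F /\ packing S).
  split; first by move=> Q [S CS SQ]; exact: (HC _ CS).1.
  move=> P; have [C0|/set0P/negP/negPn/eqP C0] := pselect (C !=set0); last first.
    rewrite C0 bigcup_set0 esum1 ?mule_ge0//.
    by move=> Q [].
  apply: esum_leP => X uX XP.
  have [|S CS SX] := @seq_in_chain _ C X totC C0.
    by move=> Q QX; have [[S CS SQ] _] := XP _ QX; exists S.
  apply: le_trans ((HC _ CS).2 P); apply: sum_le_esum => //.
  by move=> Q QX; split; [exact: SX|exact: (XP _ QX).2].
exists S; split => // Q FQ; have [SQ|nSQ] := pselect (S Q); first by left.
right; apply: contrapT => nsat.
apply: (Smax (S `|` [set Q])).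
  split; last by move=> /(_ Q (or_intror erefl)).
  by left.
split; first by move=> Q' [/SF|->].
move=> P; have [QP|nQP] := pselect (dsub Q P); last first.
  apply: le_trans (Spack P); apply: esum_subset => Q' [[SQ'|->] Q'P] //.
apply: (@le_trans _ _ (\esum_(Q' in [set Q' | S Q' /\ dsub Q' P] `|` [set Q]) (dcost Q')%:E)).
  by apply: esum_subset => Q' [[SQ'|->] Q'P]; [left|right].
apply: le_trans (esum_setU_le _ _ _) _ => //.
rewrite esum_set1// -[2%R]/(1 + 1)%R EFinD ge0_muleDl ?lee_fin// !mul1e.
apply: leeD; last by rewrite lee_fin (dcost_dsub hdelta QP).
by rewrite leNgt; apply/negP => sat; apply: nsat; exists P => //; exact: ltW.
Qed.

Definition antichain S := forall Q Q', S Q -> S Q' -> dsub Q Q' -> Q = Q'.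

Lemma antichain_disjoint S Q Q' P : antichain S -> S Q -> S Q' ->
  dsub P Q -> dsub P Q' -> Q = Q'.
Proof.
move=> anti SQ SQ' PQ PQ'.
have [QQ'|Q'Q] := dsub_total (R := R) PQ PQ'; first exact: anti QQ'.
by rewrite (anti _ _ SQ' SQ Q'Q).
Qed.

(** Given a covering of [E], a cube of [S] that lies inside a covering cube is charged to it, and
    packing limits these charges to twice the cost of the covering. Any other cube of [S] is
    covered, on [E], by the covering cubes inside it, which are disjoint families for distinct
    members of the antichain. *)
Lemma packing_sum_dcontent S E : packing S -> antichain S ->
  \esum_(Q in S) h [set x | dcube Q x /\ E x] <= 3%:E * h E.
Proof.
move=> pack anti; apply: le_dcontent_cover => // A EA.
set a := \esum_(i in A) _.
have -> : (3%:E * a = a + 2%:E * a)%E.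
  have -> : 3%:E = 1%:E + 2%:E :> \bar R by rewrite -EFinD; congr EFin; ring.
  by rewrite ge0_muleDl ?lee_fin// mul1e.
apply: (@le_trans _ _ (\esum_(Q in S)
    (\esum_(P in [set P | A P /\ dsub P Q]) (dcost P)%:E +
     \esum_(P in [set P | A P /\ dsub Q P]) (dcost Q)%:E))).
  apply: le_esum => Q SQ.
  have [[P AP QP]|none] := pselect (exists2 P, A P & dsub Q P).
    apply: (@le_trans _ _ (dcost Q)%:E).
      by apply: le_trans (dcontent_dcube_le _ Q); apply: dcontentS => x [].
    rewrite -[leLHS]add0e; apply: leeD; first exact: esum_ge0.
    by apply: (esum_ge1 (a := fun=> (dcost Q)%:E) (j := P)).
  rewrite -[leLHS]adde0; apply: leeD; last exact: esum_ge0.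
  apply: dcontent_cover => x [Qx /EA [P AP Px]]; exists P => //; split => //.
  have [//|QP] := meet_dsub_total Px Qx.
  by exfalso; apply: none; exists P.
rewrite esumD; last 2 first.
- by move=> Q _; exact: esum_ge0.
- by move=> Q _; exact: esum_ge0.
apply: leeD.
  apply: le_trans (esum_disjoint_le _ _ _) _ => //.
    by move=> Q Q' P SQ SQ'; exact: (antichain_disjoint anti SQ SQ').
  by apply: esum_subset => P [].
under eq_esum do rewrite esum_if.
rewrite esum_exchange; last by move=> Q P; case: ifP => _ //; exact: dcostE0.
rewrite -esumZ//; apply: le_esum => P AP.
by rewrite -esum_if; exact: pack.
Qed.

Lemma packing_sum S E g : packing S -> antichain S ->
  \esum_(Q in S) I [set x | dcube Q x /\ E x] g <= 3%:E * I E g.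
Proof.
move=> pack anti; rewrite /dchoquet esum_exchange; last first.
  by move=> Q k; exact: dterm_ge0.
rewrite -esumZ//; last by move=> k; exact: dterm_ge0.
apply: le_esum => k _; rewrite esumZ ?pow2_ge0//; last first.
  by move=> Q; exact: dcontent_ge0.
rewrite muleCA; apply: lee_wpmul2l; first exact: pow2E_ge0.
apply: le_trans (packing_sum_dcontent _ pack anti).
by apply: le_esum => Q _; apply: dcontentS => x /= [[Qx Ex] gx].
Qed.

End Packing.

(** * The weak-type estimate over dyadic cubes *)

Section DyadicWeakType.
Local Open Scope classical_set_scope.
Local Open Scope ring_scope.
Local Open Scope ereal_scope.
Context {R : realType} {n : nat}.
Variables (delta p A : R) (w sigma : 'rV[R]_n -> \bar R).
Implicit Types (P Q : dyadic n) (E : set 'rV[R]_n) (f g : 'rV[R]_n -> \bar R).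
Local Notation h := (dcontent delta).
Local Notation I := (dchoquet delta).
Local Notation dcost := (dcost delta).
Local Notation q := (p - 1)%R.
Hypothesis hdelta : (0 < delta <= n%:R)%R.
Hypothesis hw : muckenhoupt_pair delta p A w sigma.

Lemma dyadic_weak_type : exists2 K : R, (0 < K)%R &
  forall f (B : R), (0 <= B)%R ->
  (forall k, I [set x | (pow2 k)%:E < f x] w <= (B * pow2 k `^ (- p))%:E) ->
  forall k, I (\bigcup_(Q in [set Q | (pow2 k * dcost Q)%:E < I (dcube Q) f]) triple Q) w
    <= (K * B * pow2 k `^ (- p))%:E.
Proof.
have [c [M [c0 cM dist]]] := local_distribution hdelta hw.
(* One third is the constant of [packing_sum_dcontent]: in a saturated cube [P] the selected cubes
   fill content at least [dcost P / 3]. *)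
have third0 : (0 < 3^-1 :> R)%R by rewrite invr_gt0.
have [C C0 ainf] := Ap_infty hw third0.
have M0 : (0 <= M)%R.
  rewrite -lee_fin; apply: le_trans cM; apply: esum_ge0 => d _.
  by rewrite lee_fin mulr_ge0// exprn_ge0// powR_ge0.
(* Selected cubes and saturated cubes contribute [3 * C * B1] each; [2 ^ p] comes from the level
   [2 ^ (k - 1)] in [B1], and 1 is added for positivity. *)
exists (6 * C * M * 2 `^ p + 1)%R.
  by rewrite ltr_wpDl// !mulr_ge0 ?powR_ge0// ltW.
move=> f B B0 weak k.
set F := [set Q | _].
pose B1 : R := (B * pow2 (k - 1) `^ (- p) * M)%R.
have B10 : (0 <= B1)%R by rewrite !mulr_ge0// powR_ge0.
have I0 E : 0 <= I E w by exact: dchoquet_ge0.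
have cI0 d E : 0 <= (c d)%:E * I E w by rewrite mule_ge0 ?lee_fin.
have sumB : \esum_(d in [set: nat]) ((c d)%:E *
    I [set x | (pow2 (k - 1 + d%:Z))%:E < f x] w) <= B1%:E.
  apply: (@le_trans _ _ (\esum_(d in [set: nat])
      ((B * pow2 (k - 1) `^ (- p))%:E * (c d * (2 `^ (- p)) ^+ d)%:E))).
    apply: le_esum => d _.
    apply: le_trans (lee_wpmul2l _ (weak _)) _; first by rewrite lee_fin.
    rewrite -!EFinM lee_fin pow2D pow2_nat.
    rewrite powRM ?pow2_ge0 ?exprn_ge0// powR_exprn//.
    by rewrite le_eqVlt; apply/orP; left; apply/eqP; ring.
  rewrite esumZ; last 2 first.
  - by rewrite mulr_ge0// powR_ge0.
  - by move=> d; rewrite lee_fin mulr_ge0// exprn_ge0// powR_ge0.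
  rewrite /B1 [leRHS]EFinM; apply: lee_wpmul2l => //.
  by rewrite lee_fin mulr_ge0// powR_ge0.
(* A uniform bound on the weights in [F], which through [gen_bounded] places every cube of [F] below
   a maximal one. *)
have FB Q : F Q -> I (dcube Q) w <= B1%:E.
  move=> /dist /le_trans; apply; apply: le_trans sumB; apply: le_esum => d _.
  apply: lee_wpmul2l; first by rewrite lee_fin.
  by apply: dchoquetS => x [].
have maxF (G : set (dyadic n)) (B2 : R) : (forall Q, G Q -> I (dcube Q) w <= B2%:E) ->
    forall Q, G Q -> exists Q', [/\ G Q', dsub Q Q' &
      forall Q'', G Q'' -> dsub Q' Q'' -> Q'' = Q'].
  move=> GB Q GQ; have [K HK] := gen_bounded hdelta hw B2 Q.
  by apply: (maximal_dcube (K := K)) => // Q' GQ' QQ'; apply: HK => //; exact: GB.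
pose Fm := [set Q | F Q /\ forall Q', F Q' -> dsub Q Q' -> Q' = Q].
have [S [SF pack Ssat]] := exists_packing hdelta Fm.
have antiS : antichain S.
  by move=> Q Q' /SF [FQ Qm] /SF [FQ' _] /(Qm _ FQ') ->.
pose s : \bar R := \esum_(Q in S) I (dcube Q) w.
have sB : s <= (3 * B1)%:E.
  apply: (@le_trans _ _ (\esum_(Q in S) \esum_(d in [set: nat]) ((c d)%:E *
      I [set x | dcube Q x /\ (pow2 (k - 1 + d%:Z))%:E < f x] w))).
    by apply: le_esum => Q /SF [FQ _]; exact: dist.
  rewrite esum_exchange; last by move=> Q d; exact: cI0.
  rewrite EFinM; apply: le_trans (lee_wpmul2l _ sumB) => //.
  rewrite -esumZ//; apply: le_esum => d _.
  rewrite esumZ// muleCA; apply: lee_wpmul2l; first by rewrite lee_fin.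
  exact: (packing_sum [set x | (pow2 (k - 1 + d%:Z))%:E < f x] w pack antiS).
pose sat := [set P | (dcost P)%:E <=
    \esum_(Q in [set Q | S Q /\ dsub Q P]) (dcost Q)%:E].
have satW P : sat P -> I (triple P) w <=
    C%:E * \esum_(Q in [set Q | S Q /\ dsub Q P]) I (dcube Q) w.
  move=> satP.
  pose EP : set 'rV[R]_n := \bigcup_(Q in [set Q | S Q /\ dsub Q P]) dcube Q.
  apply: (@le_trans _ _ (C%:E * I EP w)).
    apply: ainf.
      by move=> x [Q [_ QP] Qx]; apply: dcube_triple; exact: dsub_cube Qx.
    rewrite EFinM lee_pdivrMl//; apply: le_trans satP _.
    apply: le_trans (packing_sum_dcontent EP pack antiS).
    apply: (@le_trans _ _ (\esum_(Q in [set Q | S Q /\ dsub Q P])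
        h [set x | dcube Q x /\ EP x])); last by apply: esum_subset => Q [].
    apply: le_esum => Q [SQ QP]; rewrite -(dcontent_dcube hdelta Q).
    by apply: dcontentS => x Qx; split => //; exists Q.
  apply: lee_wpmul2l; first by rewrite lee_fin ltW.
  exact: dchoquet_bigcup.
have satB P : sat P -> I (dcube P) w <= (C * (3 * B1))%:E.
  move=> satP; apply: le_trans (dchoquetS _ _ (dcube_triple (i := P))) _.
  apply: le_trans (satW P satP) _; rewrite EFinM; apply: lee_wpmul2l.
    by rewrite lee_fin ltW.
  by apply: le_trans sB; apply: esum_subset => Q [].
pose satm := [set P | sat P /\ forall P', sat P' -> dsub P P' -> P' = P].
(* Climb from [Q] to a maximal cube of [F]; it is selected, or lies in a saturated cube and so in a
   maximal saturated one. Triples grow along the way. *)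
have cover : (\bigcup_(Q in F) triple Q : set 'rV[R]_n) `<=`
    \bigcup_(Q in S `|` satm) triple Q.
  move=> x [Q FQ Qx].
  have [Q1 [FQ1 QQ1 Q1m]] := maxF F B1 FB Q FQ.
  have [|SQ1|[P Q1P satP]] := Ssat Q1; first by split.
    by exists Q1; [left|exact: triple_dsub Qx].
  have [P1 [sP1 PP1 P1m]] := maxF sat _ satB P satP.
  exists P1; first by right.
  exact: triple_dsub PP1 _ (triple_dsub Q1P (triple_dsub QQ1 Qx)).
apply: le_trans (dchoquetS _ _ cover) _.
apply: le_trans (dchoquet_bigcup _ _ _ _) _.
apply: le_trans (esum_setU_le _ _ _) _; first by move=> Q; exact: I0.
have C0E : 0 <= C%:E by rewrite lee_fin ltW.
have part1 : \esum_(Q in S) I (triple Q) w <= C%:E * (3 * B1)%:E.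
  apply: le_trans (lee_wpmul2l C0E sB).
  rewrite -esumZ ?(ltW C0)//; apply: le_esum => Q _; apply: ainf.
    exact: dcube_triple.
  rewrite dcontent_dcube// lee_fin ler_piMl ?dcost_ge0// invf_le1//.
  by rewrite ler1n.
(* Maximal saturated cubes are pairwise not nested, so the selected cubes below them form disjoint
   families and their weights add up to at most [s]. *)
have part2 : \esum_(P in satm) I (triple P) w <= C%:E * (3 * B1)%:E.
  apply: (@le_trans _ _ (\esum_(P in satm)
      (C%:E * \esum_(Q in [set Q | S Q /\ dsub Q P]) I (dcube Q) w))).
    by apply: le_esum => P [satP _]; exact: satW.
  rewrite esumZ ?(ltW C0)//; last by move=> P; exact: esum_ge0.
  apply: lee_wpmul2l => //; apply: le_trans sB.
  apply: le_trans (esum_disjoint_le _ _ _) _ => //.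
    move=> P P' Q [sP Pm] [sP' P'm] QP QP'.
    have [PP'|P'P] := dsub_total (R := R) QP QP'; first by rewrite (Pm _ sP' PP').
    by rewrite (P'm _ sP P'P).
  by apply: esum_subset => Q [].
apply: le_trans (leeD part1 part2) _.
rewrite -!EFinM -EFinD lee_fin /B1 pow2D.
rewrite powRM ?pow2_ge0// pow2N pow2_1.
have -> : ((2^-1 : R) `^ (- p) = 2 `^ p)%R.
  by rewrite -powR_inv1// -powRrM mulN1r opprK.
move: (pow2 k `^ - p)%R (powR_ge0 (pow2 k : R) (- p)) => X X0.
have := mulr_ge0 B0 X0; lra.
Qed.

End DyadicWeakType.

(** * Averages over cubes and positivity of integrals *)

Section CubeAverages.
Local Open Scope classical_set_scope.
Local Open Scope ring_scope.
Local Open Scope ereal_scope.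
Context {R : realType} {n : nat}.
Variable delta : R.
Hypothesis hdelta : (0 < delta <= n%:R)%R.
Implicit Types (E F N : set 'rV[R]_n) (f g w : 'rV[R]_n -> \bar R).
Local Notation h := (dcontent delta).
Local Notation I := (dchoquet delta).
Local Notation dcost := (dcost delta).

Lemma hausdorff_content_cube (a : 'rV[R]_n) (l : R) : (0 < l)%R ->
  hausdorff_content delta (cube a l) = (l `^ delta)%:E.
Proof.
move=> l0; apply/eqP; rewrite eq_le hausdorff_content_cube_ge// andbT.
apply: ereal_inf_lbound; exists [set 0%N], (fun=> a), (fun=> l); split => //.
  by move=> x Qx; exists 0%N.
by rewrite esum_set1// lee_fin powR_ge0.
Qed.

Lemma choquet_avg_cube (a : 'rV[R]_n) (l : R) g : (0 < l)%R ->
  choquet_avg delta (cube a l) g =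
  ((l `^ delta)^-1)%:E * choquet delta (cube a l) g.
Proof.
by move=> l0; rewrite /choquet_avg hausdorff_content_cube// inver gt_eqF// powR_gt0.
Qed.

Lemma choquet_avg_ge0 E g : 0 <= choquet_avg delta E g.
Proof.
by rewrite mule_ge0 ?choquet_ge0// inve_ge0 hausdorff_content_ge0.
Qed.

Lemma le_choquet E F g g' : E `<=` F -> (forall x, E x -> g x <= g' x) ->
  choquet delta E g <= choquet delta F g'.
Proof.
move=> EF gg; apply: le_integral_mono => t _; first exact: hausdorff_content_ge0.
apply: hausdorff_contentS => x /= [Ex gx]; split; first exact: EF.
exact: lt_le_trans (gg _ Ex).
Qed.

(** A capacitary weight is integrable on compact sets, and cubes are not closed. *)
Lemma cube_sub_compact (a : 'rV[R]_n) (l : R) :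
  exists2 K, compact K & cube a l `<=` K.
Proof.
exists [set v : 'rV[R]_n | forall o, `[(a ord0 o), (a ord0 o + l)%R]%classic (v ord0 o)].
  apply: (@rV_compact _ _ (fun o => `[(a ord0 o), (a ord0 o + l)%R]%classic)) => o.
  exact: segment_compact.
by move=> x H o /=; rewrite in_itv/=; have /andP[/ltW -> ->] := H o.
Qed.

Lemma dcontent0 : h (set0 : set 'rV[R]_n) = 0.
Proof.
apply/eqP; rewrite eq_le dcontent_ge0 andbT.
by rewrite -(esum_set0 (fun Q : dyadic n => (dcost Q)%:E)); apply: dcontent_cover.
Qed.

(** If the integral vanished, all superlevel sets would be null, and the cube would be a countable
    union of null sets. *)
Lemma dchoquet_gt0 N g (Q : dyadic n) : hausdorff_content delta N = 0 ->
  (forall x, ~ N x -> 0 < g x) -> 0 < I (dcube Q) g.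
Proof.
move=> N0 gN; rewrite lt0e dchoquet_ge0 andbT; apply/eqP => I0.
have lev0 k : h [set x | dcube Q x /\ (pow2 k)%:E < g x] = 0.
  have := dchoquet_term delta (dcube Q) g k; rewrite I0 => H.
  apply/eqP; rewrite eq_le dcontent_ge0 andbT.
  by rewrite -(@pmule_rle0 _ (pow2 k)%:E)// lte_fin pow2_gt0.
have hN : h N <= 0.
  by apply: le_trans (dcontent_le_hausdorff hdelta N) _; rewrite N0 mule0.
suff : h (dcube Q) <= 0.
  by rewrite dcontent_dcube// lee_fin leNgt dcost_gt0.
have sub : dcube Q `<=` N `|`
    \bigcup_(k in [set: int]) [set x | dcube Q x /\ (pow2 k)%:E < g x].
  move=> x Qx; have [|/gN gx] := pselect (N x); first by left.
  right; move: gx; case E : (g x) => [r| |]// gx.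
    rewrite lte_fin in gx.
    have [k /andP[k1 k2]] := pow2_bracket gx.
    by exists (k - 1)%R => //=; split => //; rewrite E lte_fin.
  by exists 0%R => //=; split => //; rewrite E ltry.
apply: le_trans (dcontentS _ sub) _; apply: le_trans (dcontentU _ _ _) _.
rewrite -[leRHS]adde0; apply: leeD => //.
apply: le_trans (dcontent_bigcup _ _ _) _.
by rewrite esum1// => k _; exact: lev0.
Qed.

End CubeAverages.

(** * From the [A_p] condition to a dyadic Muckenhoupt pair *)

Section MuckenhouptOfAp.
Local Open Scope classical_set_scope.
Local Open Scope ring_scope.
Local Open Scope ereal_scope.
Context {R : realType} {n : nat}.
Variables (delta p : R) (w : 'rV[R]_n -> \bar R).
Hypothesis hdelta : (0 < delta <= n%:R)%R.
Hypothesis p_gt1 : (1 < p)%R.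
Local Notation h := (dcontent delta).
Local Notation I := (dchoquet delta).
Local Notation dcost := (dcost delta).
Local Notation q := (p - 1)%R.

Definition dual_function (x : 'rV[R]_n) : \bar R := (w x)^-1 `^ q^-1.
Local Notation sigma := dual_function.

Let q_gt0 : (0 < q)%R. Proof. by rewrite subr_gt0. Qed.
Let iq_gt0 : (0 < q^-1)%R. Proof. by rewrite invr_gt0. Qed.

Lemma dual_function_fin x (r : R) : (0 < r)%R -> w x = r%:E ->
  sigma x = (r `^ (- q^-1))%:E.
Proof.
move=> r0 wx; rewrite /sigma wx inver gt_eqF// poweR_EFin.
by rewrite -(powR_inv1 (ltW r0)) -powRrM mulN1r.
Qed.

Lemma dual_function0 x : w x = 0 -> sigma x = +oo.
Proof. by move=> wx; rewrite /sigma wx inve0 poweRyr// gt_eqF. Qed.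

Lemma dual_functiony x : w x = +oo -> sigma x = 0.
Proof. by move=> wx; rewrite /sigma wx invey poweR0r// gt_eqF. Qed.

Lemma powR_le_inv (r t a b : R) : (0 < r)%R -> (0 < t)%R -> (0 < b)%R ->
  (a * b = 1)%R -> (r `^ (- a) <= t)%R -> (t `^ (- b) <= r)%R.
Proof.
move=> r0 t0 b0 ab H.
have : ((r `^ (- a)) `^ b <= t `^ b)%R.
  by apply: ge0_ler_powR; rewrite ?nnegrE ?powR_ge0 ?(ltW b0) ?(ltW t0).
rewrite -powRrM mulNr ab !powRN powRr1 ?(ltW r0)// => H2.
by rewrite -[leRHS]invrK lef_pV2// posrE ?invr_gt0// powR_gt0.
Qed.

Hypothesis w_ge0 : forall x, 0 <= w x.

Lemma dual_weight_sigma : dual_weight q sigma w.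
Proof.
move=> x t t0; have := w_ge0 x; case E : (w x) => [r| |]//; last by move=> *; rewrite leey.
rewrite lee_fin le_eqVlt => /predU1P[r0|r0].
  by rewrite dual_function0 ?E -?r0.
rewrite (dual_function_fin r0 E) !lee_fin.
by apply: (powR_le_inv r0 t0 q_gt0); rewrite mulVf// gt_eqF.
Qed.

Lemma dual_weight_w : dual_weight q^-1 w sigma.
Proof.
move=> x t t0; have := w_ge0 x; case E : (w x) => [r| |]//.
rewrite lee_fin le_eqVlt => /predU1P[r0|r0].
  by rewrite dual_function0 ?E -?r0// leey.
rewrite (dual_function_fin r0 E) !lee_fin => rt.
rewrite !powRN lef_pV2 ?posrE ?powR_gt0//.
by apply: ge0_ler_powR; rewrite ?nnegrE ?(ltW r0) ?(ltW t0) ?(ltW iq_gt0).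
Qed.

Hypothesis w_cap : capacitary_weight delta w.

Lemma choquet_cube_lty (a : 'rV[R]_n) (l : R) : choquet delta (cube a l) w < +oo.
Proof.
have [K cK aK] := cube_sub_compact a l.
have [_ /(_ _ cK) wK _] := w_cap.
by apply: le_lt_trans wK; exact: le_choquet.
Qed.

Lemma dchoquet_cube_lty (a : 'rV[R]_n) (l : R) : I (cube a l) w < +oo.
Proof.
apply: le_lt_trans (dchoquet_le_choquet hdelta _ _) _.
have := choquet_cube_lty a l; have := choquet_ge0 delta (cube a l) w.
by case: (choquet _ _ _) => [c| |]// _ _; rewrite -EFinM ltry.
Qed.

Lemma muckenhoupt_pair_of_Ap : Ap_const delta p w < +oo ->
  exists A, muckenhoupt_pair delta p A w sigma.
Proof.
move=> Ap_fin; have [_ _ [N N0 wN]] := w_cap.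
have [B [B0 HB]] : exists B : R, (0 <= B)%R /\ forall (a : 'rV[R]_n) l, (0 < l)%R ->
    choquet_avg delta (cube a l) w * choquet_avg delta (cube a l) sigma `^ q <= B%:E.
  have ub (a : 'rV[R]_n) l : (0 < l)%R ->
      choquet_avg delta (cube a l) w * choquet_avg delta (cube a l) sigma `^ q
        <= Ap_const delta p w.
    by move=> l0; apply: ereal_sup_ubound; exists (cube a l) => //; exists a, l.
  have ge0 : 0 <= Ap_const delta p w.
    apply: le_trans (ub 0%R 1%R ltr01).
    by rewrite mule_ge0 ?choquet_avg_ge0// poweR_ge0.
  exists (fine (Ap_const delta p w)); split; first exact: fine_ge0.
  by rewrite fineK ?ge0_fin_numE.
(* [3 ^ delta] compares the content of a triple with that of its dyadic cube, and [cchoquet] passes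
   to the dyadic integral; the powers 1 and [p - 1] combine into [D ^ p]. *)
pose D : R := (@cchoquet R n delta * 3 `^ delta)%R.
have D0 : (0 < D)%R by rewrite mulr_gt0 ?cchoquet_gt0// powR_gt0.
exists (D `^ p * B + 1)%R; split => //.
- by rewrite ltr_wpDl// mulr_ge0// powR_ge0.
- exact: dual_weight_sigma.
- exact: dual_weight_w.
- by move=> Q; apply: dchoquet_gt0 N0 _ => // x /wN /andP[].
- move=> Q; apply: dchoquet_gt0 N0 _ => // x /wN /andP[wx wy].
  have x0 : w x != 0 by rewrite gt_eqF.
  have xy : w x != +oo by rewrite lt_eqF.
  by rewrite poweR_gt0// inve_gt0.
- by move=> Q; exact: dchoquet_cube_lty.
move=> Q; set T := triple Q.
pose s : R := (3 * pow2 Q.1)%R.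
have s0 : (0 < s)%R by rewrite mulr_gt0// pow2_gt0.
pose L := (s `^ delta)%R; have L0 : (0 < L)%R by rewrite powR_gt0.
have bound g : I T g <= (D * dcost Q)%:E * choquet_avg delta T g.
  apply: le_trans (dchoquet_le_choquet hdelta _ _) _.
  rewrite choquet_avg_cube// -/s -/T muleA -EFinM.
  have -> : (D * dcost Q * (s `^ delta)^-1 = @cchoquet R n delta)%R.
    rewrite /D /s /dcost powRM ?pow2_ge0//; field.
    by rewrite !gt_eqF ?powR_gt0 ?pow2_gt0.
  by [].
have avg0 g : 0 <= choquet_avg delta T g by exact: choquet_avg_ge0.
have DL0 : (0 < D * dcost Q)%R by rewrite mulr_gt0// dcost_gt0.
apply: (@le_trans _ _ (((D * dcost Q)%:E * choquet_avg delta T w) *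
   ((D * dcost Q)%:E * choquet_avg delta T sigma) `^ q)).
  apply: lee_pmul; [exact: dchoquet_ge0|exact: poweR_ge0|exact: bound|].
  apply: gt0_ler_poweR; [exact: ltW| | |exact: bound].
    by rewrite in_itv/= dchoquet_ge0 leey.
  by rewrite in_itv/= leey andbT mule_ge0// lee_fin ltW.
rewrite poweRM ?lee_fin ?(ltW DL0)// poweR_EFin.
rewrite muleACA -EFinM mulr_powRB1 ?(ltW DL0)//; last exact: lt_trans p_gt1.
apply: (@le_trans _ _ (((D * dcost Q) `^ p)%:E * B%:E)).
  apply: lee_wpmul2l; first by rewrite lee_fin powR_ge0.
  exact: HB.
rewrite -EFinM lee_fin (powRM _ (ltW D0) (dcost_ge0 _ _)) mulrDl mul1r mulrAC.
by rewrite lerDl powR_ge0.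
Qed.

End MuckenhouptOfAp.

(** * Weak norms and the sufficiency of the [A_p] condition *)

Section WeakNorm.
Local Open Scope classical_set_scope.
Local Open Scope ring_scope.
Local Open Scope ereal_scope.
Context {R : realType} {n : nat}.
Variables (delta p : R) (w : 'rV[R]_n -> \bar R).
Hypothesis hdelta : (0 < delta <= n%:R)%R.
Hypothesis p_gt1 : (1 < p)%R.
Implicit Types (E : set 'rV[R]_n) (f g : 'rV[R]_n -> \bar R).
Local Notation h := (dcontent delta).
Local Notation I := (dchoquet delta).
Local Notation dcost := (dcost delta).
Local Notation C := (@cchoquet R n delta).

Let p_gt0 : (0 < p)%R. Proof. exact: lt_trans p_gt1. Qed.
Let ip_gt0 : (0 < p^-1)%R. Proof. by rewrite invr_gt0. Qed.

Lemma poweR_inv_le (c : \bar R) (t M : R) : 0 <= c -> (0 < t)%R -> (0 <= M)%R ->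
  (t%:E * c `^ p^-1 <= M%:E) = (c <= (M `^ p * t `^ (- p))%:E).
Proof.
move=> c0 t0 M0; case: c c0 => [c| |]// c0; last first.
  by rewrite poweRyr ?gt_eqF// gt0_muley ?lte_fin.
rewrite lee_fin in c0.
rewrite poweR_EFin -EFinM !lee_fin.
have tp0 : (0 < t `^ p)%R by rewrite powR_gt0.
rewrite powRN ler_pdivlMr//.
set u := (t * c `^ p^-1)%R; have u0 : (0 <= u)%R.
  by rewrite mulr_ge0 ?powR_ge0 ?(ltW t0).
have -> : (c * t `^ p = u `^ p)%R.
  rewrite /u (powRM _ (ltW t0) (powR_ge0 _ _)) -powRrM mulVf ?gt_eqF//.
  by rewrite (powRr1 c0) mulrC.
apply/idP/idP => H.
  by apply: ge0_ler_powR; rewrite ?nnegrE//; exact: ltW.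
rewrite leNgt; apply/negP => Mu.
have := @gt0_ltr_powR _ _ p_gt0 M u; rewrite !nnegrE => /(_ M0 u0 Mu).
by rewrite ltNge H.
Qed.

Lemma weak_norm_ge0 f : 0 <= weak_norm delta p w f.
Proof.
apply: le_trans (ereal_sup_ubound _); last by exists 1%R => //=.
by rewrite mule_ge0 ?lee_fin// poweR_ge0.
Qed.

Lemma weak_norm_leP f (M : R) : (0 <= M)%R ->
  (forall t : R, (0 < t)%R -> choquet delta [set x | t%:E < `|f x|] w
     <= (M `^ p * t `^ (- p))%:E) ->
  weak_norm delta p w f <= M%:E.
Proof.
move=> M0 H; apply: ge_ereal_sup => _ [t /= t0 <-].
by rewrite poweR_inv_le// ?choquet_ge0//; exact: H.
Qed.

Lemma weak_norm_distribution f (M t : R) : (0 <= M)%R -> (0 < t)%R ->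
  weak_norm delta p w f <= M%:E ->
  choquet delta [set x | t%:E < `|f x|] w <= (M `^ p * t `^ (- p))%:E.
Proof.
move=> M0 t0 H; rewrite -poweR_inv_le// ?choquet_ge0//.
by apply: le_trans H; apply: ereal_sup_ubound; exists t.
Qed.

Lemma maximal_ge0 f x : 0 <= maximal delta f x.
Proof.
apply: le_trans (ereal_sup_ubound _); last first.
  exists (dcube (locate 0 x)) => //; split; last exact: dcube_locate.
  by eexists; exists (pow2 0) => //; exact: pow2_gt0.
exact: choquet_avg_ge0.
Qed.

(* A cube is covered by at most [2 ^ n] dyadic cubes of comparable size, whose
   triples contain it. *)
Lemma maximal_sub_triple : exists s : nat, forall f k,
  [set x | (pow2 k)%:E < maximal delta f x] `<=`
  \bigcup_(Q in [set Q : dyadic n | (pow2 (k - s%:Z) * dcost Q)%:E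
      < I (dcube Q) (fun y => `|f y|)]) triple Q.
Proof.
have [s hs] := @expr_unbounded R 2 (@ccube R n delta) (ltr1n R 2).
exists s => f k x /= /ereal_sup_gt [_ [_ [[a [l l0 ->]] ax] <-]].
rewrite choquet_avg_cube//; set g := fun y => _ => avg.
have ld0 : (0 < l `^ delta)%R by rewrite powR_gt0.
have {}avg : (pow2 k * l `^ delta)%:E < I (cube a l) g.
  apply: lt_le_trans (choquet_le_dchoquet delta _ _).
  by rewrite mulrC EFinM -lte_pdivlMl.
have [j /andP[j1 j2]] := pow2_bracket l0.
have [[b hb]|none] := pselect (exists b, (pow2 (k - s%:Z) * dcost (corner j a b))%:E
     < I (dcube (corner j a b)) g).
  by exists (corner j a b) => //; exact: cube_sub_triple ax.
(* If all [2 ^ n] corner cubes had average at most [2 ^ (k - s)], adding them would bound the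
   integral over the cube by [2 ^ k * l ^ delta * ccube / 2 ^ s], and [ccube <= 2 ^ s]. *)
exfalso; move: avg; rewrite ltNge => /negP; apply.
apply: le_trans (dchoquetS _ _ (cube_sub_corner j2)) _.
apply: le_trans (dchoquet_bigcup _ _ _ _) _.
apply: (@le_trans _ _ (\esum_(b in [set: {ffun 'I_n -> bool}])
    (pow2 (k - s%:Z) * pow2 j `^ delta)%:E)).
  apply: le_esum => b _; rewrite leNgt; apply/negP => hb.
  by apply: none; exists b.
apply: le_trans (esum_fin_const _ _) _.
  by rewrite mulr_ge0 ?pow2_ge0 ?powR_ge0.
rewrite lee_fin card_ffun card_bool card_ord natrX pow2D pow2N pow2_nat.
have /andP[d0 _] := hdelta.
have jl : (pow2 j `^ delta <= 2 `^ delta * l `^ delta)%R.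
  rewrite -powRM ?(ltW l0)//; apply: ge0_ler_powR.
  - exact: ltW.
  - by rewrite nnegrE pow2_ge0.
  - by rewrite nnegrE mulr_ge0 ?(ltW l0).
  - by move: j1; rewrite pow2D pow2N pow2_1 => /ltW; lra.
have k0 : (0 < pow2 k :> R)%R by exact: pow2_gt0.
have s0 : (0 < 2 ^+ s :> R)%R by rewrite exprn_gt0.
have n0 : (0 <= 2 ^+ n :> R)%R by rewrite exprn_ge0.
apply: (@le_trans _ _ (2 ^+ n * (pow2 k / 2 ^+ s * (2 `^ delta * l `^ delta)))%R).
  apply: ler_wpM2l => //; apply: ler_wpM2l => //.
  by rewrite divr_ge0 ?(ltW k0) ?(ltW s0).
have -> : (2 ^+ n * (pow2 k / 2 ^+ s * (2 `^ delta * l `^ delta)) =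
   pow2 k * l `^ delta * (@ccube R n delta / 2 ^+ s))%R.
  by rewrite /ccube; ring.
rewrite ler_piMr//; first by rewrite mulr_ge0 ?(ltW k0) ?(ltW ld0).
by rewrite ler_pdivrMr// mul1r.
Qed.

Lemma maximal_weak_bounded : (exists A sigma, muckenhoupt_pair delta p A w sigma) ->
  exists2 K : R, (0 < K)%R & forall f, weak_Lp delta p w f ->
    weak_norm delta p w (maximal delta f) <= K%:E * weak_norm delta p w f.
Proof.
move=> [A [sigma hw]].
have [K K0 HK] := dyadic_weak_type hdelta hw.
have [s Hs] := maximal_sub_triple.
(* [C] passes to the dyadic integral, [2 ^ s] is the loss of level in [maximal_sub_triple], and one
   more factor 2 rounds [t] down to a power of two. *)
pose D : R := (K * C * (2 ^+ s.+1) `^ p)%R.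
have D0 : (0 < D)%R.
  by rewrite mulr_gt0 ?powR_gt0 ?exprn_gt0// mulr_gt0// cchoquet_gt0.
exists (D `^ p^-1)%R; first by rewrite powR_gt0.
move=> f wf; have N0 := weak_norm_ge0 f.
have Nfin : weak_norm delta p w f \is a fin_num by rewrite ge0_fin_numE.
move: N0 (lexx (weak_norm delta p w f)); rewrite -{1 3 4}(fineK Nfin) lee_fin.
set N := fine _ => N0 hN.
rewrite -EFinM; apply: weak_norm_leP; first by rewrite mulr_ge0 ?powR_ge0.
move=> t t0.
have Np0 : (0 <= C * N `^ p)%R by rewrite mulr_ge0 ?powR_ge0 ?(ltW (cchoquet_gt0 _)).
have weak k : I [set x | (pow2 k)%:E < `|f x|] w <= (C * N `^ p * pow2 k `^ (- p))%:E.
  apply: le_trans (dchoquet_le_choquet hdelta _ _) _.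
  have -> : (C * N `^ p * pow2 k `^ (- p))%:E =
      C%:E * (N `^ p * pow2 k `^ (- p))%:E by rewrite -EFinM mulrA.
  apply: lee_wpmul2l.
    by rewrite lee_fin (ltW (cchoquet_gt0 _)).
  exact: weak_norm_distribution (pow2_gt0 k) hN.
have [k /andP[k1 k2]] := pow2_bracket_lt t0.
have HKk := HK (fun y => `|f y|) _ Np0 weak (k - s%:Z)%R.
apply: le_trans (le_trans _ HKk) _.
  apply: le_trans (choquet_le_dchoquet delta _ _) _.
  apply: dchoquetS; apply: subset_trans (Hs f k) => x /=.
  rewrite gee0_abs ?maximal_ge0//; apply: le_lt_trans.
  by rewrite lee_fin.
rewrite lee_fin (powRM _ (powR_ge0 _ _) N0) -powRrM mulVf ?gt_eqF//.
rewrite powRr1 ?(ltW D0)// /D.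
have -> : ((2 ^+ s.+1) `^ p = (2 ^+ s.+1)^-1 `^ (- p) :> R)%R.
  by rewrite -(powR_inv1 (exprn_ge0 _ _))// -powRrM mulN1r opprK.
have H : (pow2 (k - s%:Z) `^ (- p) <= (2 ^+ s.+1)^-1 `^ (- p) * t `^ (- p))%R.
  rewrite -powRM ?invr_ge0 ?exprn_ge0 ?(ltW t0)// !powRN lef_pV2 ?posrE; last 2 first.
  - by rewrite powR_gt0// pow2_gt0.
  - by rewrite powR_gt0// mulr_gt0// invr_gt0 exprn_gt0.
  apply: ge0_ler_powR.
  - exact: ltW.
  - by rewrite nnegrE mulr_ge0 ?invr_ge0 ?exprn_ge0 ?(ltW t0).
  - by rewrite nnegrE pow2_ge0.
  - rewrite ler_pdivrMl ?exprn_gt0// exprS pow2D pow2N pow2_nat.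
    have -> : (2 * 2 ^+ s * (pow2 k / 2 ^+ s) = pow2 (k + 1) :> R)%R.
      by rewrite pow2D pow2_1; field; rewrite expf_neq0.
    exact: ltW.
have X0 : (0 <= K * (C * N `^ p))%R by rewrite mulr_ge0 ?(ltW K0).
have := ler_wpM2l X0 H.
move: (pow2 (k - s%:Z) `^ (- p))%R ((2 ^+ s.+1)^-1 `^ (- p))%R => x y.
move: (t `^ (- p))%R (N `^ p)%R C => a b c; lra.
Qed.

End WeakNorm.

(** * Necessity of the [A_p] condition *)

Section Necessity.
Local Open Scope classical_set_scope.
Local Open Scope ring_scope.
Local Open Scope ereal_scope.
Context {R : realType} {n : nat}.
Variables (delta p : R) (w : 'rV[R]_n -> \bar R).
Hypothesis hdelta : (0 < delta <= n%:R)%R.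
Hypothesis p_gt1 : (1 < p)%R.
Hypothesis w_cap : capacitary_weight delta w.
Local Notation h := (dcontent delta).
Local Notation I := (dchoquet delta).
Local Notation C := (@cchoquet R n delta).
Local Notation q := (p - 1)%R.
Local Notation sigma := (dual_function p w).

Let p_gt0 : (0 < p)%R. Proof. exact: lt_trans p_gt1. Qed.
Let q_gt0 : (0 < q)%R. Proof. by rewrite subr_gt0. Qed.
Let w_ge0 : forall x, 0 <= w x. Proof. by case: w_cap. Qed.

(** Truncation makes the integral over a cube finite, so that it can be divided by in the testing
    argument. *)
Definition truncated_dual (Q : set 'rV[R]_n) (N : int) (x : 'rV[R]_n) : \bar R :=
  if `[< Q x >] then Order.min (sigma x) (pow2 N)%:E else 0.

Lemma sigma_ge0 x : 0 <= sigma x.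
Proof. exact: poweR_ge0. Qed.

Lemma truncated_dual_ge0 Q N x : 0 <= truncated_dual Q N x.
Proof.
rewrite /truncated_dual; case: ifP => // _.
by rewrite le_min sigma_ge0 lee_fin pow2_ge0.
Qed.

Lemma lt_truncated_dual Q N x (t : R) : (0 <= t)%R ->
  (t%:E < truncated_dual Q N x) <-> [/\ Q x, t%:E < sigma x & (t < pow2 N)%R].
Proof.
move=> t0; rewrite /truncated_dual; case: asboolP => Qx; split.
- by rewrite lt_min lte_fin => /andP[].
- by move=> [_ ts tN]; rewrite lt_min ts lte_fin.
- by rewrite lte_fin ltNge t0.
- by case.
Qed.

(** The identity [sigma ^ p * w = sigma] in terms of levels: [t < sigma] gives
    [t ^ (p - 1) < 1 / w], and [1 / w < 1 / s]. *)
Lemma sigma_lt_w x (t s : R) : (0 < t)%R -> (0 < s)%R ->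
  t%:E < sigma x -> s%:E < w x -> (t `^ p * s < t)%R.
Proof.
move=> t0 s0; case E : (w x) => [r| |] //; last first.
  by rewrite dual_functiony// lte_fin ltNge (ltW t0).
move=> tr; rewrite lte_fin => sr; have r0 : (0 < r)%R by exact: lt_trans sr.
move: tr; rewrite (dual_function_fin p r0 E) lte_fin => tr.
have : (t `^ q < r^-1)%R.
  have := @gt0_ltr_powR _ _ q_gt0 t (r `^ (- q^-1))%R.
  rewrite !nnegrE => /(_ (ltW t0) (powR_ge0 _ _) tr).
  by rewrite -powRrM mulNr mulVf ?gt_eqF// powR_inv1// ltW.
have tp : (t `^ p = t * t `^ q)%R by rewrite mulr_powRB1 ?(ltW t0).
move=> H; rewrite tp -mulrA gtr_pMr//.
apply: (@lt_trans _ _ (r^-1 * s)%R); first by rewrite ltr_pM2r.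
by rewrite mulrC ltr_pdivrMr// mul1r.
Qed.

(** With [2 ^ m <= t ^ p < 2 ^ (m + 1)], the points where the truncation exceeds [t] and [w] exceeds
    [2 ^ j] satisfy [2 ^ (j + m) < t], so the truncation exceeds [2 ^ (j + m)] there. Thus the
    levels of [w] are those of the truncation shifted by [m], and the shift contributes [2 ^ (- m)],
    at most [2 * t ^ (- p)]. *)
Lemma truncated_dual_distribution Q N (t : R) : (0 < t)%R ->
  choquet delta [set x | t%:E < `|truncated_dual Q N x|] w <=
  (2 * t `^ (- p))%:E * I Q (truncated_dual Q N).
Proof.
move=> t0; set f := truncated_dual Q N.
have tp0 : (0 < t `^ p)%R by rewrite powR_gt0.
have [m /andP[m1 m2]] := pow2_bracket_lt tp0.
apply: le_trans (choquet_le_dchoquet delta _ _) _.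
apply: (@le_trans _ _ ((pow2 (- m))%:E * I Q f)); last first.
  apply: lee_wpmul2r; first exact: dchoquet_ge0.
  rewrite lee_fin pow2N powRN -ler_pdivrMl// -invfM lef_pV2 ?posrE ?pow2_gt0//.
    by move: m2; rewrite pow2D pow2_1 => /ltW; rewrite mulrC.
  by rewrite mulr_gt0 ?pow2_gt0.
rewrite /dchoquet [in leRHS](@esum_int_shift _ m) -esumZ ?pow2_ge0//; last first.
  by move=> j; exact: dterm_ge0.
apply: le_esum => j _; rewrite muleA -EFinM -pow2D.
have -> : (- m + (j + m) = j)%R by rewrite addrCA addNr addr0.
apply: lee_wpmul2l; first exact: pow2E_ge0.
apply: dcontentS => x /=; rewrite gee0_abs ?truncated_dual_ge0// => -[tf jw].
have [Qx tsig tN] := (lt_truncated_dual Q N x (ltW t0)).1 tf.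
split => //; apply: lt_trans tf; rewrite lte_fin.
apply: le_lt_trans (sigma_lt_w t0 (pow2_gt0 j) tsig jw).
by rewrite pow2D mulrC ler_wpM2r// pow2_ge0.
Qed.

Lemma truncated_dual_lty (a : 'rV[R]_n) (l : R) N : (0 < l)%R ->
  I (cube a l) (truncated_dual (cube a l) N) < +oo.
Proof.
move=> l0; apply: le_lt_trans (dchoquet_split hdelta _ _ N) _.
rewrite [X in _ + X]esum1 ?adde0; last first.
  move=> d _; rewrite (_ : [set x | _] = set0) ?dcontent0 ?mule0//.
  apply/seteqP; split => x //= -[_].
  move=> /lt_truncated_dual => /(_ (pow2_ge0 _)) [_ _].
  by rewrite ltr_pow2 gtrDl.
apply: le_lt_trans (lee_wpmul2l _ (dcontent_cube_le hdelta a l0)) _.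
  exact: pow2E_ge0.
by rewrite -EFinM ltry.
Qed.

Variable K : R.
Hypothesis K_gt0 : (0 < K)%R.
Hypothesis bounded : forall f, weak_Lp delta p w f ->
  weak_norm delta p w (maximal delta f) <= K%:E * weak_norm delta p w f.

Lemma truncated_dual_bound (a : 'rV[R]_n) (l W j : R) N : (0 < l)%R ->
  (0 <= W)%R -> choquet delta (cube a l) w = W%:E ->
  I (cube a l) (truncated_dual (cube a l) N) = j%:E -> (0 < j)%R ->
  (W * j `^ q <= 2 * K `^ p * (2 * C * l `^ delta) `^ p)%R.
Proof.
move=> l0 W0 hW hj j0; set Q := cube a l in hW hj *.
set f := truncated_dual Q N in hj *.
set L := (l `^ delta)%R; have L0 : (0 < L)%R by rewrite powR_gt0.
have C0 : (0 < C)%R by exact: cchoquet_gt0.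
have CL0 : (0 < 2 * C * L)%R by rewrite mulr_gt0// mulr_gt0.
(* Half of the lower bound [j / (C * L)] for the average of [f] over [Q], so that the maximal
   function exceeds [t] strictly on all of [Q]. *)
pose t := (j / (2 * C * L))%R; have t0 : (0 < t)%R by rewrite divr_gt0.
have M0 : (0 <= (2 * j) `^ p^-1)%R by exact: powR_ge0.
have Mp : (((2 * j) `^ p^-1) `^ p = 2 * j)%R.
  by rewrite -powRrM mulVf ?gt_eqF// powRr1// mulr_ge0// ltW.
have wf : weak_norm delta p w f <= ((2 * j) `^ p^-1)%:E.
  apply: weak_norm_leP => // s s0; apply: le_trans (truncated_dual_distribution _ _ s0) _.
  by rewrite hj -EFinM Mp lee_fin le_eqVlt; apply/orP; left; apply/eqP; ring.
have wMf : weak_norm delta p w (maximal delta f) <= (K * (2 * j) `^ p^-1)%:E.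
  apply: le_trans (bounded _) _; first exact: le_lt_trans wf (ltry _).
  by rewrite EFinM; apply: lee_wpmul2l => //; rewrite lee_fin ltW.
have := weak_norm_distribution p_gt1 (mulr_ge0 (ltW K_gt0) M0) t0 wMf.
have QM : Q `<=` [set x | t%:E < `|maximal delta f x|].
  move=> x Qx /=; apply: lt_le_trans (lee_abs _).
  apply: (@lt_le_trans _ _ (choquet_avg delta Q (fun y => `|f y|))); last first.
    by apply: ereal_sup_ubound; exists Q => //; split => //; exists a, l.
  rewrite choquet_avg_cube// -/L lte_pdivlMl//.
  have -> : (fun y => `|f y|) = f.
    by apply/funext => y; rewrite gee0_abs// truncated_dual_ge0.
  have : j%:E <= C%:E * choquet delta Q f by rewrite -hj; exact: dchoquet_le_choquet.
  rewrite -lee_pdivrMl//; apply: lt_le_trans.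
  rewrite -!EFinM lte_fin /t.
  have -> : (L * (j / (2 * C * L)) = C^-1 * j / 2)%R by field; rewrite !gt_eqF.
  by rewrite gtr_pMr ?mulr_gt0 ?invr_gt0// invf_lt1// ltr1n.
move=> /(le_trans (le_choquet delta QM (fun x _ => lexx (w x)))).
rewrite hW lee_fin => H.
have jq0 : (0 < j `^ q)%R by rewrite powR_gt0.
apply: le_trans (ler_wpM2r (ltW jq0) H) _.
rewrite (powRM _ (ltW K_gt0) M0) Mp powRN /t (powRM _ (ltW j0)) ?invr_ge0 ?(ltW CL0)//.
have -> : ((2 * C * L)^-1 `^ p = ((2 * C * L) `^ p)^-1)%R.
  by rewrite -(powR_inv1 (ltW CL0)) -powRrM mulN1r powRN.
have -> : (j `^ p = j * j `^ q)%R by rewrite mulr_powRB1 ?(ltW j0).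
have X0 : (0 < (2 * C * L) `^ p)%R by rewrite powR_gt0.
rewrite le_eqVlt; apply/orP; left; apply/eqP.
move: (j `^ q)%R ((2 * C * L) `^ p)%R (K `^ p)%R jq0 X0 => x y z x0 y0.
by field; rewrite !gt_eqF.
Qed.

Lemma seq_int_bound (s : seq int) : exists N : int, forall k, k \in s -> (k < N)%R.
Proof.
elim: s => [|k s [N HN]]; first by exists 0%R.
exists (Order.max (k + 1) N)%R => j; rewrite inE lt_max => /predU1P[->|/HN ->].
  by rewrite ltrDl.
by rewrite orbT.
Qed.

Lemma Ap_const_lty : Ap_const delta p w < +oo.
Proof.
pose D : R := (2 * K `^ p * (2 * C) `^ p)%R.
have C0 : (0 < C)%R by exact: cchoquet_gt0.
have D0 : (0 <= D)%R by rewrite mulr_ge0 ?powR_ge0// mulr_ge0 ?powR_ge0.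
apply: (@le_lt_trans _ _ D%:E); last exact: ltry.
apply: ge_ereal_sup => _ [_ [a [l l0 ->]] <-].
rewrite -/(dual_function p w) !choquet_avg_cube//.
set Q := cube a l; set L := (l `^ delta)%R.
have L0 : (0 < L)%R by rewrite powR_gt0.
have iL0 : (0 < L^-1)%R by rewrite invr_gt0.
have := choquet_cube_lty w_cap a l; have := choquet_ge0 delta Q w.
rewrite -/Q; case hW : (choquet delta Q w) => [W| |]// W_ge0 _.
have [W0|W0] := ltP 0%R W; last first.
  have -> : W = 0%R by apply/eqP; rewrite eq_le W0 -lee_fin W_ge0.
  by rewrite mule0 mul0e lee_fin.
pose X := ((D * L `^ p / W) `^ q^-1)%R.
have X0 : (0 <= X)%R by exact: powR_ge0.
have Xq : (X `^ q = D * L `^ p / W)%R.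
  by rewrite -powRrM mulVf ?gt_eqF// powRr1// divr_ge0 ?(ltW W0)// mulr_ge0// powR_ge0.
have JX N : I Q (truncated_dual Q N) <= X%:E.
  have := truncated_dual_lty a N l0; have := dchoquet_ge0 delta Q (truncated_dual Q N).
  rewrite -/Q; case hj : (I Q (truncated_dual Q N)) => [j| |]// _ _.
  rewrite lee_fin; have [j0|j0] := ltP 0%R j; last exact: le_trans j0 X0.
  have := truncated_dual_bound l0 (ltW W0) hW hj j0; rewrite -/L.
  rewrite (powRM _ _ (ltW L0)) ?mulr_ge0 ?(ltW C0)// mulrA -/D => H.
  rewrite leNgt; apply/negP => Xj.
  have := @gt0_ltr_powR _ _ q_gt0 X j; rewrite !nnegrE => /(_ X0 (ltW j0) Xj).
  by rewrite Xq ltr_pdivrMr// [(j `^ q * _)%R]mulrC ltNge H.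
(* A finite partial sum involves finitely many levels, all below some [2 ^ N], where [sigma] and its
   truncation have the same superlevel sets in [Q]; the bound, uniform in [N], thus passes to
   [sigma] without a monotone convergence theorem. *)
have SX : choquet delta Q sigma <= X%:E.
  apply: le_trans (choquet_le_dchoquet delta _ _) _.
  apply: esum_leP => Y uY _; have [N HN] := seq_int_bound Y.
  apply: le_trans (JX N).
  apply: (@le_trans _ _ (\sum_(k <- Y)
    ((pow2 k)%:E * h [set x | Q x /\ (pow2 k)%:E < truncated_dual Q N x]))).
    rewrite big_seq [leRHS]big_seq; apply: lee_sum => k kY.
    apply: lee_wpmul2l; first exact: pow2E_ge0.
    apply: dcontentS => x /= [Qx kx]; split => //.
    by apply/lt_truncated_dual; [exact: pow2_ge0|split => //; rewrite ltr_pow2; exact: HN].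
  exact: sum_le_esum.
apply: (@le_trans _ _ ((L^-1)%:E * W%:E * ((L^-1)%:E * X%:E) `^ q)).
  apply: lee_wpmul2l; first by rewrite mule_ge0 ?lee_fin ?(ltW iL0) ?(ltW W0).
  have iLE : 0 <= (L^-1)%:E by rewrite lee_fin ltW.
  have S0 := choquet_ge0 delta Q sigma.
  apply: gt0_ler_poweR; [exact: ltW| | |exact: lee_wpmul2l].
    by rewrite in_itv/= leey andbT mule_ge0.
  by rewrite in_itv/= leey andbT mule_ge0// lee_fin.
have -> : ((L^-1)%:E * X%:E = (L^-1 * X)%:E)%E by [].
rewrite poweR_EFin -!EFinM lee_fin.
rewrite (powRM _ (ltW iL0) X0) Xq.
have -> : (L^-1 `^ q = (L `^ q)^-1)%R.
  by rewrite -(powR_inv1 (ltW L0)) -powRrM mulN1r powRN.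
have -> : (L `^ p = L * L `^ q)%R by rewrite mulr_powRB1 ?(ltW L0).
have Lq0 : (0 < L `^ q)%R by rewrite powR_gt0.
rewrite le_eqVlt; apply/orP; left; apply/eqP.
by field; rewrite !gt_eqF.
Qed.

End Necessity.

Local Open Scope classical_set_scope.
Local Open Scope ring_scope.

Theorem theorem1p12 (R : realType) (n : nat) (delta p : R)
    (w : 'rV[R]_n -> \bar R)
    (hdelta : 0 < delta <= n%:R) (hp : 1 < p)
    (hw : capacitary_weight delta w) :
  (exists2 K : R, 0 < K &
     forall f : 'rV[R]_n -> \bar R, weak_Lp delta p w f ->
       (weak_norm delta p w (maximal delta f)
          <= K%:E * weak_norm delta p w f)%E)
  <-> Ap delta p w.
Proof.
split=> [[K K0 bounded]|[_ Ap_fin]].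
  by split => //; exact: (Ap_const_lty hdelta hp hw K0 bounded).
apply: maximal_weak_bounded => //.
have [w0 _ _] := hw.
have [A hA] := muckenhoupt_pair_of_Ap hdelta hp w0 hw Ap_fin.
by exists A, (dual_function p w).
Qed.
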